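(* Let $\Omega\subseteq\mathbb{R}^n$ be open, let $\nu,C_1,\dots,C_{n-1}\in\mathcal{C}^\infty(\Omega,\mathbb{R})$, put $H:=C_{n-1}$, and let $X$ be the vector field on $\Omega$ with components $X_i=\nu\cdot\frac{\partial(C_1,\dots,C_{n-2},x_i,H)}{\partial(x_1,\dots,x_n)}$, $i=1,\dots,n$. Let $\overline{x}_e\in\mathcal{E}^{C_{n-1}}_{C_1,\dots,C_{n-2}}$ be a non-degenerate regular equilibrium point of $X$, and let $\mathcal{I}_X(\overline{x}_e)$ be the associated scalar quantity. Then: (1) if $\mathcal{I}_X(\overline{x}_e)<0$, the equilibrium $\overline{x}_e$ of $X$ is unstable; (2) if $\mathcal{I}_X(\overline{x}_e)>0$, the equilibrium $\overline{x}_e$ of $X$ is Lyapunov stable.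
   Context: $\langle\cdot,\cdot\rangle$ is the standard inner product on $\mathbb{R}^n$ and $\nabla$ the corresponding gradient. $\frac{\partial(C_1,\dots,C_{n-2},x_i,H)}{\partial(x_1,\dots,x_n)}$ denotes the Jacobian determinant of the map $(C_1,\dots,C_{n-2},x_i,H):\Omega\to\mathbb{R}^n$. Thus $X$ is the Hamiltonian vector field of $H$ for the Poisson bracket defined by $\{f,g\}\,\mathrm{d}x_1\wedge\dots\wedge \mathrm{d}x_n=\nu\,\mathrm{d}C_1\wedge\dots\wedge\mathrm{d}C_{n-2}\wedge\mathrm{d}f\wedge\mathrm{d}g$, whose Casimirs include $C_1,\dots,C_{n-2}$. For decomposable $k$-vectors define $\langle u_1\wedge\dots\wedge u_k,v_1\wedge\dots\wedge v_k\rangle_k:=\det[\langle u_i,v_j\rangle]_{1\le i,j\le k}$. The set of regular equilibria is $\mathcal{E}^{C_{n-1}}_{C_1,\dots,C_{n-2}}:=\{\overline{x}\in\Omega:\ \nu(\overline{x})\neq0,\ \nabla C_1(\overline{x})\wedge\dots\wedge\nabla C_{n-2}(\overline{x})\neq0,\ \nabla C_1(\overline{x})\wedge\dots\wedge\nabla C_{n-1}(\overline{x})=0\}$. For $\overline{x}_e$ in this set there is a unique $\overrightarrow{\lambda_e}=(\lambda^e_1,\dots,\lambda^e_{n-2})\in\mathbb{R}^{n-2}$ with $\nabla H(\overline{x}_e)+\sum_i\lambda^e_i\nabla C_i(\overline{x}_e)=0$; set $F_{\overrightarrow{\lambda_e}}:=H+\sum_{i=1}^{n-2}\lambda^e_iC_i$.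 $\overline{x}_e$ is called non-degenerate if $\det(\operatorname{Hess}F_{\overrightarrow{\lambda_e}}(\overline{x}_e))\neq0$, where $\operatorname{Hess}F(\overline{x})=\mathrm{D}(\nabla F)(\overline{x})$. For such $\overline{x}_e$, writing $A:=\operatorname{Hess}F_{\overrightarrow{\lambda_e}}(\overline{x}_e)$, $\mathcal{I}_X(\overline{x}_e):=\nu^2(\overline{x}_e)\det(A)\,\langle A^{-1}\nabla C_1(\overline{x}_e)\wedge\dots\wedge A^{-1}\nabla C_{n-2}(\overline{x}_e),\ \nabla C_1(\overline{x}_e)\wedge\dots\wedge\nabla C_{n-2}(\overline{x}_e)\rangle_{n-2}$. *)

(* Defs.v *)
From HB Require Import structures.
From mathcomp Require Import all_boot all_order all_algebra.
From mathcomp Require Import all_classical all_reals all_analysis.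
Set Implicit Arguments. Unset Strict Implicit. Unset Printing Implicit Defensive.
Import Order.TTheory GRing.Theory Num.Theory.
Import numFieldNormedType.Exports.
Local Open Scope classical_set_scope.
Local Open Scope ring_scope.

Section Defs.
Variables (R : realType) (n : nat).
Notation V := 'rV[R]_n.

Definition basis_vec (i : 'I_n) : V := delta_mx 0 i.

Definition partial (i : 'I_n) (f : V -> R) (x : V) : R := 'D_(basis_vec i) f x.

Definition grad (f : V -> R) (x : V) : V := \row_i partial i f x.

Definition hess (f : V -> R) (x : V) : 'M[R]_n :=
  \matrix_(i, j) partial j (partial i f) x.

Definition dotp (u v : V) : R := (u *m v^T) 0 0.

Fixpoint iter_deriv (vs : seq V) (f : V -> R) : V -> R :=
  match vs with
  | [::] => f
  | v :: vs' => 'D_v (iter_deriv vs' f)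
  end.

Definition smooth_on (O : set V) (f : V -> R) : Prop :=
  forall (vs : seq V) (x : V), O x -> differentiable (iter_deriv vs f) x.

(* <u_1 /\ ... /\ u_k , v_1 /\ ... /\ v_k>_k := det [<u_i, v_j>] *)
Definition wedge_inner (k : nat) (u v : 'I_k -> V) : R :=
  \det (\matrix_(i, j) dotp (u i) (v j)).

Definition rows_mx (k : nat) (w : 'I_k -> V) : 'M[R]_(k, n) :=
  \matrix_(i, j) w i 0 j.

(* w_1 /\ ... /\ w_k <> 0  iff  w_1, ..., w_k are linearly independent *)
Definition wedge_nonzero (k : nat) (w : 'I_k -> V) : Prop :=
  row_free (rows_mx w).

End Defs.

Section System.
Variables (R : realType) (m : nat).
(* dimension n = m.+2 ; Casimirs C_1..C_{n-2} are C : 'I_m -> _, H = C_{n-1} *)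
Notation n := m.+2.
Notation V := 'rV[R]_n.

(* rows grad C_1, ..., grad C_{n-2}, grad x_i (= e_i), grad H *)
Definition jac_rows (C : 'I_m -> V -> R) (H : V -> R) (i : 'I_n) (x : V)
  : 'M[R]_n :=
  \matrix_(k < n, j < n)
    (match (insub (k : nat) : option 'I_m) with
     | Some k' => grad (C k') x 0 j
     | None => if (k == m :> nat) then @basis_vec R n i 0 j else grad H x 0 j
     end).

Definition vfield (nu : V -> R) (C : 'I_m -> V -> R) (H : V -> R) (x : V) : V :=
  \row_i (nu x * \det (jac_rows C H i x)).

Definition all_grads (C : 'I_m -> V -> R) (H : V -> R) (x : V) : 'I_m.+1 -> V :=
  fun k => if unlift ord_max k is Some k' then grad (C k') x else grad H x.

Definition regular_equilibrium (O : set V) (nu : V -> R) (C : 'I_m -> V -> R)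
  (H : V -> R) (x : V) : Prop :=
  [/\ O x, nu x != 0,
      wedge_nonzero (fun k => grad (C k) x) &
      ~ wedge_nonzero (all_grads C H x)].

Definition F_lam (C : 'I_m -> V -> R) (H : V -> R) (lam : 'I_m -> R) : V -> R :=
  fun x => H x + \sum_(i < m) lam i * C i x.

Definition I_X (nu : V -> R) (C : 'I_m -> V -> R) (H : V -> R)
  (lam : 'I_m -> R) (x : V) : R :=
  let A := hess (F_lam C H lam) x in
  nu x ^+ 2 * \det A *
  wedge_inner (fun k => (invmx A *m (grad (C k) x)^T)^T)
              (fun k => grad (C k) x).

Definition is_solution (O : set V) (X : V -> V) (a b : R) (g : R -> V) : Prop :=
  forall t, a < t < b -> O (g t) /\ is_derive t 1 g (X (g t)).

Definition lyapunov_stable (O : set V) (X : V -> V) (xe : V) : Prop :=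
  forall eps : R, 0 < eps -> exists2 delta : R, 0 < delta &
    forall x0 : V, O x0 -> `|x0 - xe| < delta ->
      (exists (g : R -> V) (a : R), [/\ a < 0, g 0 = x0 &
           forall b, 0 < b -> is_solution O X a b g]) /\
      (forall (g : R -> V) (a b : R), a < 0 -> 0 < b -> g 0 = x0 ->
           is_solution O X a b g ->
           forall t, 0 <= t < b -> `|g t - xe| < eps).

Definition unstable (O : set V) (X : V -> V) (xe : V) : Prop :=
  ~ lyapunov_stable O X xe.

End System.

(* Main.v *)
(* At [xe] put G = (dC_1, ..., dC_m), F = F_lam and A = Hess F.  A block determinant
   computation gives det A * det (G A^-1 G^T) = det (A | ker G) up to a positive factor,
   so the sign of I_X decides whether A is definite or indefinite on the plane ker G.
   Choose an A-orthogonal basis u, v of this plane.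

   If A | ker G is definite, then for suitable constants s and k the conserved quantity
   s (F - F(xe)) + k sum_i (C_i - C_i(xe))^2 has a strict quadratic minimum at xe, and
   orbits cannot leave its small sublevel sets.  Global existence of orbits comes from
   Picard iteration for the field composed with the projection onto a small cube, which
   is globally Lipschitz and bounded.

   If A | ker G is indefinite, let a = <u A, x - xe> and b = <v A, x - xe>.  Since
   <w, X> = nu det (dC_1, ..., dC_m, w, dF), the linearization of X gives
   a' ~ om b / <v A, v> and b' ~ - om a / <u A, u> with om <> 0, so that +-(a b) has a
   definite derivative.  Then +-(a b) - sum_i (C_i - C_i(xe))^2 is a Chetaev function:
   it is positive at points arbitrarily close to xe and grows along their orbits. *)
Require Import Defs.
From HB Require Import structures.
From mathcomp Require Import all_boot all_order all_algebra.
From mathcomp Require Import all_classical all_reals all_analysis.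
From mathcomp Require Import ring lra.
Import Order.TTheory GRing.Theory Num.Theory.
Import numFieldNormedType.Exports.
Local Open Scope classical_set_scope.
Local Open Scope ring_scope.

Set Implicit Arguments.
Unset Strict Implicit.

(** * Differential inequalities and Picard iteration *)

(** The linearization at [xe] takes its values in ker G, so it has rank at most 2; on ker G its
    eigenvalues have square - om^2 / (alpha beta), with alpha = <u A, u> and beta = <v A, v>. In the
    definite case they are imaginary and the linear part decides nothing, whence the use of
    conserved quantities. In the indefinite case a Chetaev function takes the place of an unstable
    manifold.

    [F] is preferred to [H] because its gradient vanishes at [xe], while the field is unchanged: the
    two gradients differ by a combination of Casimir gradients, which are already rows of the
    determinant. The strict sign of I_X gives more than a sign: it makes det (G A^-1 G^T) nonzero,
    hence A | ker G nondegenerate, hence alpha and beta nonzero, and one may divide by them.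

    Stability as defined includes existence of forward orbits for all time, so claim (2) must
    construct them. Instability is its negation, so in claim (1) the assumed stability itself
    supplies the orbit that is followed and keeps it in a small ball. *)

Lemma ler_row_norm {R : realType} n (x : 'rV[R]_n) (e : R) :
  0 <= e -> (forall i, `|x 0 i| <= e) -> `|x| <= e.
Proof.
move=> e0 xe; rewrite {1}/Num.Def.normr/= mx_normrE (bigmax_le _ e0)//= => -[i j] _ /=.
by rewrite (ord1 i) xe.
Qed.

Lemma ler_coord_norm {R : realType} n (x : 'rV[R]_n) i : `|x 0 i| <= `|x|.
Proof.
rewrite [leRHS]/Num.Def.normr/= mx_normrE.
exact: (le_bigmax _ (fun ij : 'I_1 * 'I_n => `|x ij.1 ij.2|) (0, i)).
Qed.

Lemma is_derive_coord {R : realType} n (g : R -> 'rV[R]_n) (t : R) (v : 'rV[R]_n) i :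
  is_derive t 1 g v -> is_derive t 1 (fun s => g s 0 i) (v 0 i).
Proof.
move=> [dg <-]; have dgi := (derivable_mxP g t 1).1 dg 0 i.
by rewrite (derive_mx dg) mxE; apply: DeriveDef.
Qed.

Lemma is_derive_row {R : realType} n (g : R -> 'rV[R]_n) (t : R) (v : 'rV[R]_n) :
  (forall i, is_derive t 1 (fun s => g s 0 i) (v 0 i)) -> is_derive t 1 g v.
Proof.
move=> dg; have dg1 : derivable g t 1.
  by apply/derivable_mxP => i j; rewrite (ord1 i); case: (dg j).
apply: DeriveDef => //; rewrite (derive_mx dg1).
by apply/rowP => j; rewrite mxE; case: (dg j).
Qed.

Lemma is_derive_continuous {R : realType} (V : normedModType R) (f : R -> V) (t : R) v :
  is_derive t 1 f v -> {for t, continuous f}.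
Proof. by move=> [/derivable1_diffP df _]; exact: differentiable_continuous. Qed.

Lemma is_derive_within_continuous {R : realType} (V : normedModType R)
    (f : R -> V) (df : R -> V) (a b : R) :
  (forall t, a <= t <= b -> is_derive t 1 f (df t)) ->
  {within `[a, b], continuous f}.
Proof.
move=> dfE; apply: continuous_in_subspaceT => x; rewrite inE/= in_itv/= => xab.
exact: is_derive_continuous (dfE x xab).
Qed.

Lemma is_derive_le {R : realType} (f g df dg : R -> R) (a b : R) : a <= b ->
  (forall t, a <= t <= b -> is_derive t 1 f (df t)) ->
  (forall t, a <= t <= b -> is_derive t 1 g (dg t)) ->
  (forall t, a <= t <= b -> df t <= dg t) ->
  f b - f a <= g b - g a.
Proof.
move=> ab hf hg h.
have hgf t : a <= t <= b -> is_derive t 1 (g - f) (dg t - df t).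
  by move=> tab; apply: is_deriveB; [exact: hg|exact: hf].
have [c] := @MVT_segment _ (g - f) (fun t => dg t - df t) a b ab
  (fun t tab => hgf t (subset_itv_oo_cc tab)) (is_derive_within_continuous hgf).
rewrite in_itv/= => cab; rewrite -![(g - f) _]/(g _ - f _) => e.
rewrite -subr_ge0 (_ : _ - _ = (g b - f b) - (g a - f a)); last by ring.
by rewrite e mulr_ge0 ?subr_ge0// h.
Qed.

(** The norm of a row vector is the sup norm, so the claim splits into coordinates, each compared
    from above with [g] and from below with [- g]. *)
Lemma is_derive_norm_le {R : realType} n (f df : R -> 'rV[R]_n) (g dg : R -> R) (a b : R) :
  a <= b ->
  (forall t, a <= t <= b -> is_derive t 1 f (df t)) ->
  (forall t, a <= t <= b -> is_derive t 1 g (dg t)) ->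
  (forall t, a <= t <= b -> `|df t| <= dg t) ->
  `|f b - f a| <= g b - g a.
Proof.
move=> ab hf hg h; have dg0 t : a <= t <= b -> 0 <= dg t.
  by move=> /h; exact: le_trans.
have c0 t : a <= t <= b -> is_derive t 1 (cst 0 : R -> R) 0 by move=> _; exact: is_derive_cst.
have := is_derive_le ab c0 hg dg0; rewrite subrr => gab.
have hn i t : a <= t <= b -> `|df t 0 i| <= dg t.
  by move=> /h; apply: le_trans; exact: ler_coord_norm.
apply: ler_row_norm => // i; rewrite !mxE ler_norml.
have hfi t : a <= t <= b -> is_derive t 1 (fun s => f s 0 i) (df t 0 i).
  by move=> /hf; exact: is_derive_coord.
apply/andP; split; last first.
  apply: (is_derive_le ab hfi hg) => t /(hn i).
  by rewrite ler_norml => /andP[].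
have hN t : a <= t <= b -> is_derive t 1 (- g) (- dg t) by move=> /hg ?; exact: is_deriveN.
have := is_derive_le ab hN hfi.
rewrite -![(- g) _]/(- g _) (_ : - g b - - g a = - (g b - g a)); last by ring.
apply => t /(hn i).
by rewrite ler_norml => /andP[].
Qed.

Lemma continuous_antiderivative {R : realType} (f : R -> R) (c : R) :
  c < 0 -> continuous f ->
  exists2 F : R -> R, F 0 = 0 & forall t : R, c < t -> is_derive t 1 F (f t).
Proof.
move=> c0 cf; pose G (x : R) : R := (\int[lebesgue_measure]_(s in `[c, x]) f s)%R.
(* The integral starts at [c < 0] so that [0] is interior and two-sided derivatives are available
   there; subtracting [G 0] restores the initial value. *)
exists (G - cst (G 0)); first by rewrite -[(_ - _) 0]/(G 0 - G 0) subrr.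
move=> t ct; have [||dG GE] := @continuous_FTC1_closed R f c t (t + 1) _ _ ct (cf t).
- by rewrite ltrDl.
- apply: continuous_compact_integrable; first exact: segment_compact.
  exact: continuous_subspaceT.
- rewrite -[f t]subr0; apply: is_deriveB.
  by apply: DeriveDef => //; rewrite -derive1E.
Qed.

Lemma continuous_row_antiderivative {R : realType} n (f : R -> 'rV[R]_n) (c : R) :
  c < 0 -> continuous f ->
  exists2 F : R -> 'rV[R]_n, F 0 = 0 & forall t : R, c < t -> is_derive t 1 F (f t).
Proof.
move=> c0 cf; have H (i : 'I_n) : {F : R -> R | F 0 = 0 &
    forall t : R, c < t -> is_derive t 1 F (f t 0 i)}.
  apply: cid2; apply: (@continuous_antiderivative R (fun t => f t 0 i)) => // t.
  exact: (@continuous_comp _ _ _ f (fun M : 'rV[R]_n => M 0 i) t (cf t) (@coord_continuous _ _ _ _ _ _)).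
exists (fun t => \row_i s2val (H i) t).
  by apply/rowP => i; rewrite !mxE (s2valP (H i)).
move=> t ct; apply: (@is_derive_row R n _ t (f t)) => i.
rewrite [X in is_derive _ _ X _](_ : _ = s2val (H i)); last first.
  by apply/funext => s; rewrite mxE.
by case: (H i) => F /= _; exact.
Qed.

Lemma near_dist_lt {R : realType} (V : normedModType R) (x : V) (e : R) :
  0 < e -> \forall y \near x, `|x - y| < e.
Proof. by move=> e0; apply/nbhs_ballP; exists e => // y; rewrite -ball_normE. Qed.

Lemma lipschitz_continuous {R : realType} (V W : normedModType R) (f : V -> W) (L : R) :
  (forall x y, `|f x - f y| <= L * `|x - y|) -> continuous f.
Proof.
move=> lipf x; apply/cvgrPdist_lt => e e0; near=> y.
have L1 : 0 < `|L| + 1 by rewrite ltr_wpDl.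
apply: (@le_lt_trans _ _ ((`|L| + 1) * `|x - y|)).
  rewrite (le_trans (lipf _ _))// ler_wpM2r//.
  by rewrite (le_trans (ler_norm _))// lerDl.
rewrite -ltr_pdivlMl//; near: y.
by apply: near_dist_lt; rewrite mulr_gt0 ?invr_gt0.
Unshelve. all: by end_near. Qed.

Lemma exp2V_lt {R : realType} (c e : R) : 0 <= c -> 0 < e -> exists N, c / 2 ^+ N < e.
Proof.
move=> c0 e0; have [N cN] : exists N : nat, c / e < N%:R.
  by exists (Num.bound (c / e)); rewrite archi_boundP// divr_ge0// ltW.
exists N; rewrite ltr_pdivrMr ?exprn_gt0// mulrC -ltr_pdivrMr//.
by rewrite (lt_trans cN)// -natrX ltr_nat ltn_expl.
Qed.

Lemma geometric_cauchy {R : realType} n (x : nat -> 'rV[R]_n) (c : R) : 0 <= c ->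
  (forall k, `|x k.+1 - x k| <= c / 2 ^+ k) ->
  exists l, forall k, `|x k - l| <= 2 * c / 2 ^+ k.
Proof.
move=> c0 hx.
have e0 k : 0 < 2 ^+ k :> R by rewrite exprn_gt0.
(* The subtracted term makes the induction on [j] close exactly, since each increment c / 2^(k+j) is
   the decrease of 2 c / 2^(k+j). *)
have hd k j : `|x (k + j)%N - x k| <= 2 * c / 2 ^+ k - 2 * c / 2 ^+ (k + j).
  elim: j => [|j IH]; first by rewrite addn0 !subrr normr0.
  rewrite addnS -(subrKA (x (k + j)%N)) (le_trans (ler_normD _ _))//.
  have := lerD (hx (k + j)%N) IH; move=> /le_trans; apply.
  have := e0 (k + j)%N; have := e0 k; rewrite exprS; move: (2 ^+ _) (2 ^+ _) => p q p0 q0.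
  rewrite le_eqVlt; apply/orP; left; apply/eqP; field.
  by rewrite !gt_eqF.
have hd' k j : (k <= j)%N -> `|x j - x k| <= 2 * c / 2 ^+ k.
  move=> kj; rewrite -(subnKC kj) (le_trans (hd _ _))// gerBl.
  by rewrite mulr_ge0// ?mulr_ge0// invr_ge0 ltW.
have : cvg (x @ \oo).
  apply/cauchy_cvgP/cauchy_exP => e /= ee0.
  have [N Ne] := @exp2V_lt _ (2 * c) e (mulr_ge0 (ler0n _ 2) c0) ee0.
  exists (x N); exists N => // j /= Nj.
  by rewrite -ball_normE/= distrC (le_lt_trans (hd' _ _ Nj)).
move=> /cvg_ex[l xl]; exists l => k; apply/ler_addgt0Pr => e ee0.
have [N _ hN] := (cvgrPdist_lt _ _).1 xl _ ee0.
rewrite -(subrKA (x (maxn k N))) (le_trans (ler_normD _ _))// lerD//.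
  by rewrite distrC hd'// leq_maxl.
by rewrite distrC ltW// hN//= leq_maxr.
Qed.

(* The weight [expR (2 * L * t)] turns the Picard operator into a contraction:
   integrating [2 * L * B * expR (2 * L * s)] from [0] to [t] costs no constant
   as long as the weight stays above [1/2]. *)
Lemma weighted_bound {R : realType} n (f df : R -> 'rV[R]_n) (L B eta t : R) :
  0 < L -> 0 <= B -> 4 * L * eta <= 1 -> - eta < t -> 0 < eta -> f 0 = 0 ->
  (forall s : R, - eta < s -> is_derive s 1 f (df s)) ->
  (forall s, - eta < s -> `|df s| <= 2 * L * B * expR (2 * L * s)) ->
  `|f t| <= B * expR (2 * L * t).
Proof.
move=> L0 B0 Le et eta0 f0 hf hdf.
pose g (s : R) := B * expR (2 * L * s).
have hg (s : R) : is_derive s 1 g (2 * L * B * expR (2 * L * s)).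
  have h1 : is_derive s 1 (fun s : R => expR (2 * L * s)) (2 * L * expR (2 * L * s)).
    have h : is_derive s 1 ( *%R (2 * L)) (2 * L).
      by apply: is_derive_eq; rewrite /GRing.scale/= mulr1.
    rewrite [X in is_derive _ _ _ X]mulrC.
    exact: (@is_derive1_comp _ expR ( *%R (2 * L)) s _ _ (is_derive_expR _) h).
  have h2 : is_derive s 1 g (B *: (2 * L * expR (2 * L * s))) := is_deriveZ B h1.
  by apply: is_derive_eq; rewrite /GRing.scale/=; ring.
have g0 : g 0 = B by rewrite /g mulr0 expR0 mulr1.
have [t0|t0] := leP 0 t.
  have := @is_derive_norm_le _ _ f df g (fun s => 2 * L * B * expR (2 * L * s)) _ _ t0.
  rewrite f0 subr0 g0 => H.
  have : `|f t| <= g t - B.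
    apply: H => s /andP[s0 _]; last by apply: hdf; rewrite (lt_le_trans _ s0)// oppr_lt0.
    by apply: hf; rewrite (lt_le_trans _ s0)// oppr_lt0.
  by rewrite /g; lra.
have := @is_derive_norm_le _ _ f df g (fun s => 2 * L * B * expR (2 * L * s)) _ _ (ltW t0).
rewrite f0 sub0r normrN g0 => H.
have {}H : `|f t| <= B - g t.
  by apply: H => s /andP[s0 _]; [apply: hf|apply: hdf]; rewrite (lt_le_trans _ s0).
have : 1/2 <= expR (2 * L * t).
  by apply: le_trans (expR_ge1Dx _); nra.
move: H; rewrite /g; set w := expR _ => H hw; nra.
Qed.

(** Picard iteration with the exponential weight contracts by 1/2 on a whole half-line, so no local
    solutions have to be glued. The backward time [d] = 1 / (4 L) is the largest one that
    [weighted_bound] admits. *)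
Lemma global_solution {R : realType} n (Y : 'rV[R]_n -> 'rV[R]_n) (L M : R) x0 :
  0 < L -> (forall x y, `|Y x - Y y| <= L * `|x - y|) -> (forall x, `|Y x| <= M) ->
  exists (g : R -> 'rV[R]_n) (a : R), [/\ a < 0, g 0 = x0 &
    forall t : R, a < t -> is_derive t 1 g (Y (g t))].
Proof.
move=> L0 lipY bY; have M0 : 0 <= M by exact: le_trans (bY 0).
pose d := (4 * L)^-1; have d0 : 0 < d by rewrite invr_gt0 mulr_gt0.
have Ld : 4 * L * d = 1 by rewrite mulfV// gt_eqF// mulr_gt0.
have Ycont : continuous Y by exact: lipschitz_continuous lipY.
(* One Picard step. Continuity of [u] is a premise inside the existential, so that choice yields an
   operator on all functions; a discontinuous [u] gets a dummy image. *)
have step (eta : R) : 0 < eta -> forall u : R -> 'rV[R]_n, exists v : R -> 'rV[R]_n,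
    continuous u -> [/\ continuous v, v 0 = x0 &
      forall t : R, - eta < t -> is_derive t 1 v (Y (u t))].
  move=> eta0 u; have [cu|] := pselect (continuous u); last by exists u.
  have [||F F0 dF] := @continuous_row_antiderivative R n (Y \o u) (- (2 * eta)) _ _.
  - by rewrite oppr_lt0 mulr_gt0.
  - by move=> t; apply: continuous_comp; [exact: cu|exact: Ycont].
  (* Freezing time at [- eta] makes the iterate continuous on the whole line, as the next step
     requires, although [F] is only controlled to the right of [- (2 * eta)]. *)
  pose rho (t : R) := Num.max t (- eta).
  exists (fun t => x0 + F (rho t)) => _; split.
  - move=> t; apply: (@continuousD _ _ _ (cst x0) (F \o rho)); first exact: cst_continuous.
    apply: continuous_comp.
      by apply: continuous_max; [exact: cvg_id|exact: cst_continuous].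
    apply: (is_derive_continuous (dF _ _)).
    by rewrite /rho lt_max; apply/orP; right; lra.
  - by rewrite /rho max_l ?F0 ?addr0//; lra.
  - move=> t te; rewrite -[Y _]add0r.
    have H : is_derive t 1 (cst x0 + F) (0 + Y (u t)).
      by apply: is_deriveD; apply: dF; lra.
    apply: near_eq_is_derive H.
    near=> s; rewrite -[(cst _ + _) _]/(x0 + F s) /rho max_l// ltW//.
    by near: s; exact: lt_nbhsr.
have [Phi hPhi] := choice (step d d0).
pose u k := iter k Phi (cst x0).
have cu k : continuous (u k).
  by elim: k => [|k IH]; [exact: cst_continuous|have [] := hPhi _ IH].
have u0 k : u k 0 = x0 by case: k => // k; have [] := hPhi _ (cu k).
have du k (t : R) : - d < t -> is_derive t 1 (u k.+1) (Y (u k t)).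
  by have [_ _] := hPhi _ (cu k); apply.
(* Since the weight is at least 1/2, this [B] makes [2 * L * B * expR (2 * L * s)] at least [M],
   which bounds the derivative of the first increment. *)
pose B := M / L; have B0 : 0 <= B by rewrite divr_ge0// ltW.
have ub k t : - d < t -> `|u k.+1 t - u k t| <= B / 2 ^+ k * expR (2 * L * t).
  elim: k t => [|k IH] t td.
    rewrite expr0 divr1.
    have H (s : R) : - d < s -> is_derive s 1 (u 1%N - u 0%N) (Y (u 0%N s) - 0).
      by move=> sd; apply: is_deriveB; exact: du.
    apply: (weighted_bound L0 B0 _ td d0 _ H); rewrite ?Ld//.
      by rewrite -[(_ - _) 0]/(u 1%N 0 - u 0%N 0) !u0 subrr.
    move=> s sd; rewrite subr0 (le_trans (bY _))//.
    have : 1/2 <= expR (2 * L * s) by apply: le_trans (expR_ge1Dx _); nra.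
    have -> : 2 * L * B = 2 * M by rewrite /B; field; rewrite gt_eqF.
    by nra.
  have H (s : R) : - d < s -> is_derive s 1 (u k.+2 - u k.+1) (Y (u k.+1 s) - Y (u k s)).
    by move=> sd; apply: is_deriveB; exact: du.
  have Bk : 0 <= B / 2 ^+ k.+1 by rewrite divr_ge0// exprn_ge0.
  apply: (weighted_bound L0 Bk _ td d0 _ H); rewrite ?Ld//.
    by rewrite -[(_ - _) 0]/(u k.+2 0 - u k.+1 0) !u0 subrr.
  move=> s sd; rewrite (le_trans (lipY _ _))//.
  have -> : 2 * L * (B / 2 ^+ k.+1) = L * (B / 2 ^+ k).
    by rewrite exprS; field; rewrite gt_eqF// exprn_gt0.
  by rewrite -mulrA ler_pM2l// IH.
have lim t : exists l, - d < t ->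
    forall k, `|u k t - l| <= 2 * (B * expR (2 * L * t)) / 2 ^+ k.
  have [td|td] := ltP (- d) t; last by exists 0.
  have [|k|l hl] := @geometric_cauchy _ _ (fun k => u k t) (B * expR (2 * L * t)).
  - by rewrite mulr_ge0// expR_ge0.
  - by rewrite (le_trans (ub _ _ td))// mulrAC.
  - by exists l.
have [g hg] := choice lim.
(* The limit [g] is controlled only to the right of [- d]; freezing time at [- e] makes it a
   continuous function on the line, to which [step] applies once more. *)
pose e := d / 2; have e0 : 0 < e by rewrite divr_gt0.
have ed : e < d by rewrite /e; lra.
pose rho (t : R) := Num.max t (- e).
(* Every iterate is [M]-Lipschitz in time, and the bound passes to the limit; this gives the
   continuity of [g]. *)
have lipu k s t : - d < s -> s <= t -> `|u k t - u k s| <= M * (t - s).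
  move=> sd st; case: k => [|k]; first by rewrite subrr normr0 mulr_ge0// subr_ge0.
  have hM (r : R) : is_derive r 1 (fun r : R => M * r) M.
    by apply: is_derive_eq; rewrite /GRing.scale/= mulr1.
  rewrite mulrBr; apply: (is_derive_norm_le st (df := fun r => Y (u k r)) _ (fun r _ => hM r)).
  - by move=> r /andP[sr _]; apply: du; exact: lt_le_trans sr.
  - by move=> r _; exact: bY.
have lipg s t : - d < s -> s <= t -> `|g t - g s| <= M * (t - s).
  move=> sd st; have td : - d < t by exact: lt_le_trans st.
  apply/ler_addgt0Pr => eps eps0.
  pose c := 2 * (B * expR (2 * L * t)) + 2 * (B * expR (2 * L * s)).
  have c0 : 0 <= c by rewrite addr_ge0// mulr_ge0// mulr_ge0// expR_ge0.
  have [N hN] := exp2V_lt c0 eps0.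
  have h1 := hg t td N; have h2 := hg s sd N; have h3 := lipu N s t sd st.
  have -> : g t - g s = - (u N t - g t) + (u N s - g s) + (u N t - u N s).
    by apply/rowP => i; rewrite !mxE; ring.
  rewrite (le_trans (ler_normD _ _))// addrC lerD// (le_trans (ler_normD _ _))// normrN.
  by rewrite (le_trans (lerD h1 h2))// -mulrDl ltW.
have crho (t : R) : {for t, continuous rho}.
  by apply: continuous_max; [exact: cvg_id|exact: cst_continuous].
have rhod t : - d < rho t by rewrite /rho lt_max ltrN2 ed orbT.
have cg : continuous (g \o rho).
  move=> t; apply/cvgrPdist_lt => eps eps0.
  have lip s : `|g (rho t) - g (rho s)| <= M * `|rho t - rho s|.
    have [st|/ltW ts] := leP (rho s) (rho t).
      by rewrite (@ger0_norm _ (rho t - rho s)) ?subr_ge0// lipg.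
    by rewrite distrC (distrC (rho t)) (@ger0_norm _ (rho s - rho t)) ?subr_ge0// lipg.
  near=> s; rewrite /= (le_lt_trans (lip _))//.
  apply: (@le_lt_trans _ _ ((M + 1) * `|rho t - rho s|)).
    by rewrite ler_wpM2r// lerDl.
  rewrite -ltr_pdivlMl; last by lra.
  near: s; apply: (cvgr_dist_lt _ _ (crho t)).
  by rewrite mulr_gt0// invr_gt0; lra.
have [G hG] := step e e0 (g \o rho); have {hG}[_ G0 dG] := hG cg.
(* [G] and [u k.+1] are the Picard images of [g] and [u k], so [G] is close to [u k.+1], which tends
   to [g]: the limit is a fixed point. *)
have gG t : - e < t -> g t = G t.
  move=> te; have td : - d < t by lra.
  apply/eqP; rewrite -subr_eq0 -normr_le0; apply/ler_addgt0Pr => eps eps0.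
  pose c := 2 * (B * expR (2 * L * t)) + 2 * (B * expR (2 * L * t)).
  have c0 : 0 <= c by rewrite addr_ge0// mulr_ge0// mulr_ge0// expR_ge0.
  have [k hk] := exp2V_lt c0 eps0.
  have Bk : 0 <= 2 * B / 2 ^+ k by apply: divr_ge0; [exact: mulr_ge0|exact: exprn_ge0].
  have H (s : R) : - e < s -> is_derive s 1 (u k.+1 - G) (Y (u k s) - Y (g s)).
    move=> se; apply: is_deriveB; first by apply: du; lra.
    by have := dG s se; rewrite /= /rho max_l// ltW.
  have := weighted_bound L0 (B := 2 * B / 2 ^+ k) Bk _ te e0 _ H.
  have -> : (u k.+1 - G) t = u k.+1 t - G t by [].
  move=> /(_ _ _ _)H1.
  have {}H1 : `|u k.+1 t - G t| <= 2 * B / 2 ^+ k * expR (2 * L * t).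
    apply: H1.
    - by move: Ld; rewrite /e; lra.
    - by rewrite -[(_ - _) 0]/(u k.+1 0 - G 0) u0 G0 subrr.
    move=> s se; have sd : - d < s by lra.
    rewrite (le_trans (lipY _ _))// (le_trans (ler_wpM2l (ltW L0) (hg s sd k)))//.
    have w0 : 0 < expR (2 * L * s) by exact: expR_gt0.
    have -> : L * (2 * (B * expR (2 * L * s)) / 2 ^+ k) =
      L * (2 * B / 2 ^+ k) * expR (2 * L * s) by ring.
    by rewrite ler_pM2r//; move: Bk; set q := 2 * B / _ => q0; nra.
  have h2 := hg t td k.+1.
  rewrite -(subrKA (u k.+1 t)) (le_trans (ler_normD _ _))// add0r distrC.
  rewrite (le_trans (lerD h2 H1))// (le_trans _ (ltW hk))// /c.
  have p0 : 0 < 2 ^+ k :> R by rewrite exprn_gt0.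
  have q0 : 0 <= B * expR (2 * L * t) / 2 ^+ k.
    by apply: divr_ge0; [apply: mulr_ge0 => //; exact: expR_ge0|exact: ltW].
  rewrite exprS.
  have -> : 2 * (B * expR (2 * L * t)) / (2 * 2 ^+ k) = B * expR (2 * L * t) / 2 ^+ k.
    by field; rewrite gt_eqF.
  by lra.
exists G, (- e); split => //; first by rewrite oppr_lt0.
by move=> t te; have := dG t te; rewrite /= /rho max_l ?gG// ltW.
Unshelve. all: by end_near. Qed.

(** * Calculus on row vectors *)

Lemma near_ballP {R : realType} (V : normedModType R) (x : V) (P : V -> Prop) :
  (\forall y \near x, P y) <-> exists2 r : R, 0 < r & forall y, `|y - x| < r -> P y.
Proof.
split=> [/nbhs_ballP[r /= r0 rP]|[r r0 rP]].
  by exists r => // y yx; apply: rP; rewrite -ball_normE/= distrC.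
by apply/nbhs_ballP; exists r => // y; rewrite -ball_normE/= distrC => /rP.
Qed.

Section gradient.
Context {R : realType} {n : nat}.
Notation V := 'rV[R]_n.
Implicit Types (f : V -> R) (u v w x y z : V).

Lemma dotpE u v : dotp u v = \sum_i u 0 i * v 0 i.
Proof. by rewrite /dotp !mxE; apply: eq_bigr => i _; rewrite mxE. Qed.

Lemma dotpDr u v w : dotp u (v + w) = dotp u v + dotp u w.
Proof. by rewrite /dotp linearD/= mulmxDr mxE. Qed.

Lemma dotpZr u v k : dotp u (k *: v) = k * dotp u v.
Proof. by rewrite /dotp linearZ/= -scalemxAr mxE. Qed.

Lemma dotpC u v : dotp u v = dotp v u.
Proof. by rewrite !dotpE; apply: eq_bigr => i _; rewrite mulrC. Qed.

Lemma dotp_basis u i : dotp u (basis_vec R i) = u 0 i.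
Proof.
rewrite dotpE (bigD1 i)//= big1 => [|j ji]; rewrite /basis_vec !mxE.
  by rewrite !eqxx mulr1 addr0.
by rewrite (negbTE ji) andbF mulr0.
Qed.

Lemma ler_norm_dotp u v : `|dotp u v| <= (\sum_i `|u 0 i|) * `|v|.
Proof.
rewrite dotpE mulr_suml (le_trans (ler_norm_sum _ _ _))// ler_sum// => i _.
by rewrite normrM ler_wpM2l// ler_coord_norm.
Qed.

Lemma norm_basis_vec (i : 'I_n) : `|basis_vec R i| <= 1.
Proof.
apply: ler_row_norm => // j; rewrite /basis_vec mxE.
by case: (_ && _); rewrite ?normr1 ?normr0.
Qed.

Lemma diff_dotp_grad f x v : differentiable f x -> 'd f x v = dotp (grad f x) v.
Proof.
move=> df; rewrite {1}(row_sum_delta v) linear_sum dotpE; apply: eq_bigr => i _.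
by rewrite linearZ/= mulrC /grad mxE /partial deriveE.
Qed.

Lemma grad_expansion f x (e : R) : differentiable f x -> 0 < e ->
  exists2 r : R, 0 < r & forall y, `|y - x| < r ->
    `|f y - f x - dotp (grad f x) (y - x)| <= e * `|y - x|.
Proof.
move=> df e0; have /eqaddoP/(_ _ e0)/near_ballP[r r0 hr] := diff_locally df.
exists r => // y yx; have := hr (y - x); rewrite subr0 => /(_ yx).
rewrite -diff_dotp_grad//.
suff -> : f y - f x - 'd f x (y - x) = f (y - x + x) - (f x + 'd f x (y - x)) by [].
by rewrite subrK opprD addrA.
Qed.

Lemma is_derive_comp_grad f (g : R -> V) (t : R) v :
  is_derive t 1 g v -> differentiable f (g t) ->
  is_derive t 1 (f \o g) (dotp (grad f (g t)) v).
Proof.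
move=> dg df; have dg' : differentiable g t by apply/derivable1_diffP; case: dg.
have dfg : differentiable (f \o g) t by exact: differentiable_comp.
apply: DeriveDef; first exact/derivable1_diffP.
rewrite deriveE// diff_comp//= -diff_dotp_grad//; congr ('d f _ _).
by rewrite -deriveE//; case: dg.
Qed.

Lemma is_derive_line f x v (s : R) : differentiable f (x + s *: v) ->
  is_derive s 1 (fun s => f (x + s *: v)) (dotp (grad f (x + s *: v)) v).
Proof.
move=> df; apply: (@is_derive_comp_grad f (fun s => x + s *: v)) => //.
apply: is_derive_row => i.
rewrite [X in is_derive _ _ X _](_ : _ = (fun s : R => x 0 i + s * v 0 i)).
  by apply: is_derive_eq; rewrite /GRing.scale/=; ring.
by apply/funext => r; rewrite !mxE.
Qed.

(** The mean value theorem along e_i turns the second difference into h times a difference of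
    [partial i f] at two points, and both values are expanded with the differential of [partial i f]
    at [x]. *)
Lemma second_difference f x (i j : 'I_n) (e : R) :
  (\forall y \near x, differentiable f y) -> differentiable (partial i f) x -> 0 < e ->
  exists2 r : R, 0 < r & forall h, 0 < h < r ->
    `|f (x + h *: basis_vec R i + h *: basis_vec R j) - f (x + h *: basis_vec R i)
      - f (x + h *: basis_vec R j) + f x - h ^+ 2 * partial j (partial i f) x|
    <= e * h ^+ 2.
Proof.
move=> /near_ballP[r1 r10 df] dif e0.
(* The two points lie within 2 h and h of [x], so the errors add up to three times e / 3. *)
have e3 : 0 < e / 3 by rewrite divr_gt0.
have [r2 r20 hr2] := grad_expansion dif e3.
exists (Num.min r1 r2 / 2); first by rewrite divr_gt0// lt_min r10.
move=> h /andP[h0 hr].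
set ei := basis_vec R i; set ej := basis_vec R j.
have ni : `|ei| <= 1 by exact: norm_basis_vec.
have nj : `|ej| <= 1 by exact: norm_basis_vec.
have hr12 : 2 * h < Num.min r1 r2 by lra.
have {hr hr12} [hr1 hr3] : 2 * h < r1 /\ 2 * h < r2.
  by move: hr12; rewrite lt_min => /andP[].
have nb1 s : 0 <= s <= h -> `|s *: ei| <= h.
  move=> /andP[s0 sh]; rewrite normrZ ger0_norm//.
  by rewrite (le_trans (ler_wpM2l s0 ni))// mulr1.
have nb2 s : 0 <= s <= h -> `|h *: ej + s *: ei| <= 2 * h.
  move=> /nb1 sh; rewrite (le_trans (ler_normD _ _))// mulr_natl mulr2n lerD//.
  rewrite normrZ (gtr0_norm h0).
  by rewrite (le_trans (ler_wpM2l (ltW h0) nj))// mulr1.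
pose phi (s : R) := f (x + h *: ej + s *: ei) - f (x + s *: ei).
have dphi (s : R) : 0 <= s <= h -> is_derive s 1 phi
    (partial i f (x + h *: ej + s *: ei) - partial i f (x + s *: ei)).
  move=> s0h; have h1 := @is_derive_line f (x + h *: ej) ei s.
  have h2 := @is_derive_line f x ei s.
  rewrite !dotp_basis !mxE in h1 h2.
  apply: is_deriveB; first apply: h1; last apply: h2.
    by apply: df; rewrite -(addrA x) (addrC (x + _)) addKr (le_lt_trans (nb2 _ s0h)).
  apply: df; rewrite (addrC (x + _)) addKr (le_lt_trans (nb1 _ s0h))//; lra.
have [c] := MVT_segment (ltW h0) (fun s sh => dphi s (subset_itv_oo_cc sh))
  (is_derive_within_continuous dphi).
rewrite in_itv/= => c0h; rewrite subr0 /phi scale0r !addr0 => E.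
have E1 : `|partial i f (x + h *: ej + c *: ei) - partial i f x
    - dotp (grad (partial i f) x) (h *: ej + c *: ei)| <= e / 3 * (2 * h).
  have := hr2 (x + h *: ej + c *: ei).
  rewrite -(addrA x) (addrC (x + _)) addKr => /(_ (le_lt_trans (nb2 _ c0h) hr3)).
  by move=> /le_trans; apply; rewrite ler_pM2l// nb2.
have E2 : `|partial i f (x + c *: ei) - partial i f x
    - dotp (grad (partial i f) x) (c *: ei)| <= e / 3 * h.
  have := hr2 (x + c *: ei); rewrite (addrC (x + _)) addKr => H.
  apply: le_trans (H _) _; last by rewrite ler_pM2l// nb1.
  by rewrite (le_lt_trans (nb1 _ c0h))//; lra.
rewrite dotpDr !dotpZr !dotp_basis in E1; rewrite dotpZr dotp_basis in E2.
have gE : grad (partial i f) x 0 j = partial j (partial i f) x by rewrite mxE.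
rewrite gE in E1.
rewrite (addrAC x).
move: E E1 E2; rewrite -/ei -/ej.
set a := partial i f (x + _ + _); set b := partial i f (x + _).
set P := partial i f x; set Pj := partial j _ x; set Pi := grad _ _ _ _ => E E1 E2.
have -> : f (x + h *: ej + h *: ei) - f (x + h *: ei) - f (x + h *: ej) + f x - h ^+ 2 * Pj
   = h * ((a - P - (h * Pj + c * Pi)) - (b - P - c * Pi)).
  move: E; lra.
rewrite normrM gtr0_norm//.
apply: (@le_trans _ _ (h * (e / 3 * (2 * h) + e / 3 * h))); last first.
  by rewrite le_eqVlt; apply/orP; left; apply/eqP; field.
by rewrite ler_pM2l// (le_trans (ler_normB _ _))// lerD.
Qed.

(** The second difference is symmetric in [i] and [j], so both mixed derivatives, times h^2,
    approximate the same number up to a small multiple of h^2. This is what makes the Hessian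
    symmetric. *)
Lemma partialC f x (i j : 'I_n) :
  (\forall y \near x, differentiable f y) ->
  differentiable (partial i f) x -> differentiable (partial j f) x ->
  partial j (partial i f) x = partial i (partial j f) x.
Proof.
move=> df di dj; apply/eqP; rewrite -subr_eq0 -normr_le0; apply/ler_addgt0Pr => e e0.
have e2 : 0 < e / 2 by rewrite divr_gt0.
have [r1 r10 h1] := second_difference j df di e2.
have [r2 r20 h2] := second_difference i df dj e2.
pose h := Num.min r1 r2 / 2.
have m0 : 0 < Num.min r1 r2 by rewrite lt_min r10.
have h0 : 0 < h by rewrite divr_gt0.
have hm : h < Num.min r1 r2 by rewrite /h; lra.
have [hr1 hr2] : h < r1 /\ h < r2 by move: hm; rewrite lt_min => /andP[].
have {}h1 := h1 h; rewrite h0 hr1 in h1; have {}h1 := h1 isT.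
have {}h2 := h2 h; rewrite h0 hr2 in h2; have {}h2 := h2 isT.
rewrite (addrAC x) in h2; move: h1 h2.
set fij := f (x + _ + _); set fi := f (x + _); set fj := f (x + _).
set a := partial j _ x; set b := partial i _ x => h1 h2.
have h20 : 0 < h ^+ 2 by rewrite exprn_gt0.
rewrite add0r -(ler_pM2l h20) -{1}(gtr0_norm h20) -normrM.
have -> : h ^+ 2 * (a - b) = (fij - fj - fi + f x - h ^+ 2 * b)
    - (fij - fi - fj + f x - h ^+ 2 * a) by ring.
rewrite (le_trans (ler_normB _ _))// (le_trans (lerD h2 h1))//.
by rewrite le_eqVlt; apply/orP; left; apply/eqP; field.
Qed.

(** The regularity class of the whole argument: it is closed under sums and products, hence under
    determinants, and supplies both the Lipschitz bound for Picard iteration and the coefficients of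
    first-order expansions. *)
Definition locally_lipschitz x f := exists r K : R, [/\ 0 < r, 0 <= K &
  forall y z, `|y - x| < r -> `|z - x| < r -> `|f y - f z| <= K * `|y - z|].

Lemma locally_lipschitz_bounded x f : locally_lipschitz x f ->
  exists r K M : R, [/\ 0 < r, 0 <= K, 0 <= M &
  forall y z, `|y - x| < r -> `|z - x| < r ->
    `|f y - f z| <= K * `|y - z| /\ `|f y| <= M].
Proof.
move=> [r [K [r0 K0 H]]]; exists r, K, (K * r + `|f x|).
have xr : `|x - x| < r by rewrite subrr normr0.
split => //; first by rewrite addr_ge0// mulr_ge0// ltW.
move=> y z yr zr; split; first exact: H.
rewrite -[f y](subrK (f x)) (le_trans (ler_normD _ _))// lerD2r.
by rewrite (le_trans (H _ _ yr xr))// ler_wpM2l// ltW.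
Qed.

Lemma locally_lipschitz_cst x (c : R) : locally_lipschitz x (fun=> c).
Proof. by exists 1, 0; split=> // y z _ _; rewrite subrr normr0 mul0r. Qed.

Lemma locally_lipschitzD x f g : locally_lipschitz x f -> locally_lipschitz x g ->
  locally_lipschitz x (fun y => f y + g y).
Proof.
move=> [r1 [K1 [r10 K10 H1]]] [r2 [K2 [r20 K20 H2]]].
exists (Num.min r1 r2), (K1 + K2); split; [by rewrite lt_min r10|exact: addr_ge0|].
move=> y z; rewrite !lt_min => /andP[y1 y2] /andP[z1 z2].
rewrite opprD addrACA (le_trans (ler_normD _ _))// mulrDl lerD//; [exact: H1|exact: H2].
Qed.

Lemma locally_lipschitzM x f g : locally_lipschitz x f -> locally_lipschitz x g ->
  locally_lipschitz x (fun y => f y * g y).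
Proof.
move=> /locally_lipschitz_bounded[r1 [K1 [M1 [r10 K10 M10 H1]]]].
move=> /locally_lipschitz_bounded[r2 [K2 [M2 [r20 K20 M20 H2]]]].
exists (Num.min r1 r2), (M1 * K2 + K1 * M2); split; first by rewrite lt_min r10.
  by rewrite addr_ge0// mulr_ge0.
move=> y z; rewrite !lt_min => /andP[y1 y2] /andP[z1 z2].
have [f1 f2] := H1 _ _ y1 z1; have [g1 _] := H2 _ _ y2 z2.
have [_ g2] := H2 _ _ z2 y2.
have -> : f y * g y - f z * g z = f y * (g y - g z) + (f y - f z) * g z by ring.
rewrite (le_trans (ler_normD _ _))// !normrM mulrDl lerD//.
  by rewrite -mulrA ler_pM.
by rewrite mulrAC ler_pM.
Qed.

Lemma locally_lipschitz_sum (I : Type) (s : seq I) (P : pred I) (F : I -> V -> R) x :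
  (forall i, P i -> locally_lipschitz x (F i)) ->
  locally_lipschitz x (fun y => \sum_(i <- s | P i) F i y).
Proof.
move=> HF; elim: s => [|i s IH].
  by under eq_fun do rewrite big_nil; exact: locally_lipschitz_cst.
case Pi : (P i); under eq_fun do rewrite big_cons Pi.
  exact: locally_lipschitzD (HF i Pi) IH.
exact: IH.
Qed.

Lemma locally_lipschitz_prod (I : Type) (s : seq I) (F : I -> V -> R) x :
  (forall i, locally_lipschitz x (F i)) ->
  locally_lipschitz x (fun y => \prod_(i <- s) F i y).
Proof.
move=> HF; elim: s => [|i s IH].
  by under eq_fun do rewrite big_nil; exact: locally_lipschitz_cst.
by under eq_fun do rewrite big_cons; exact: locally_lipschitzM (HF i) IH.
Qed.

(** Partial derivatives are bounded near [x], and the mean value theorem applies along segments,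
    which stay in the ball by convexity. The constant is a sum over coordinates because the l1 norm
    is dual to the sup norm. *)
Lemma C1_locally_lipschitz x f :
  (\forall y \near x, differentiable f y) ->
  (forall i, {for x, continuous (partial i f)}) ->
  locally_lipschitz x f.
Proof.
move=> df cf.
have bf : \forall y \near x, forall i, `|partial i f y| <= `|partial i f x| + 1.
  apply: (@filter_forall _ _ (fun i y => `|partial i f y| <= `|partial i f x| + 1) (nbhs x)) => i; near=> y.
  rewrite -[partial i f y](subrK (partial i f x)) (le_trans (ler_normD _ _))//.
  rewrite addrC lerD2l distrC ltW//; near: y.
  exact: (cvgr_dist_lt _ _ (cf i)).
have /near_ballP[r r0 hr] : \forall y \near x, differentiable f y /\
    forall i, `|partial i f y| <= `|partial i f x| + 1.
  by near=> y; split; near: y.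
pose K := \sum_(i < n) (`|partial i f x| + 1).
have K0 : 0 <= K by apply: sumr_ge0 => i _; rewrite addr_ge0.
exists r, K; split => // y z yr zr.
have seg (s : R) : 0 <= s <= 1 -> `|z + s *: (y - z) - x| < r.
  move=> /andP[s0 s1].
  have -> : z + s *: (y - z) - x = (1 - s) *: (z - x) + s *: (y - x).
    by apply/rowP => i; rewrite !mxE; ring.
  rewrite (le_lt_trans (ler_normD _ _))// !normrZ ger0_norm ?subr_ge0// (ger0_norm s0).
  have : Num.max `|z - x| `|y - x| < r by rewrite gt_max zr.
  apply: le_lt_trans.
  have : `|z - x| <= Num.max `|z - x| `|y - x| by rewrite le_max lexx.
  have : `|y - x| <= Num.max `|z - x| `|y - x| by rewrite le_max lexx orbT.
  move: `|z - x| `|y - x| => p q; move: (Num.max _ _) => M; nra.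
have dl (s : R) : 0 <= s <= 1 -> is_derive s 1 (fun s => f (z + s *: (y - z)))
    (dotp (grad f (z + s *: (y - z))) (y - z)).
  by move=> s01; apply: is_derive_line; have [] := hr _ (seg s s01).
have [c] := MVT_segment ler01 (fun s sh => dl s (subset_itv_oo_cc sh))
  (is_derive_within_continuous dl).
rewrite in_itv/= => c01; rewrite scale1r scale0r addr0 (addrC z) subrK subr0 mulr1 => ->.
rewrite (le_trans (ler_norm_dotp _ _))// ler_wpM2r// ler_sum// => i _.
by have [_] := hr _ (seg c c01); rewrite /grad mxE.
Unshelve. all: by end_near. Qed.
End gradient.

(** * Quadratic forms on the kernel of the Casimir differentials *)

Lemma det_mx2 {F : comPzRingType} (M : 'M[F]_2) :
  \det M = M 0 0 * M 1 1 - M 0 1 * M 1 0.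
Proof.
rewrite (expand_det_row _ 0) !big_ord_recl big_ord0 addr0 /cofactor !det_mx11 !mxE/=.
rewrite expr0 mul1r expr1 mulN1r mulrN.
by congr (_ * M _ _ - M _ _ * M _ _); exact/val_inj.
Qed.

(** Orthogonal basis for the binary form with matrix ((p, q), (q, r)): complete a square when [p] or
    [r] is nonzero; otherwise the form is 2 q x y, and sum and difference of the basis vectors are
    orthogonal. *)
Lemma diagonalize2 {F : realFieldType} (p q r : F) : p * r - q ^+ 2 != 0 ->
  exists x y z w : F, x * w - y * z != 0 /\
    x * z * p + (x * w + y * z) * q + y * w * r = 0.
Proof.
move=> d; have [p0|p0] := eqVneq p 0; last first.
  exists 1, 0, (- q / p), 1; split; last by field.
  by rewrite mul0r subr0 mulr1 oner_eq0.
have [r0|r0] := eqVneq r 0; last first.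
  exists 1, (- q / r), 0, 1; split; last by field.
  by rewrite mulr0 subr0 mulr1 oner_eq0.
exists 1, 1, 1, (-1); split; last by rewrite p0 r0; ring.
rewrite (_ : 1 * -1 - 1 * 1 = - 2); last by ring.
by rewrite oppr_eq0 pnatr_eq0.
Qed.

Lemma gram_unitmx {R : realType} k n (N : 'M[R]_(k, n)) :
  row_free N -> N *m N^T \in unitmx.
Proof.
move=> Nf; rewrite -row_free_unit; apply: inj_row_free => z zN.
apply: (row_free_inj Nf); rewrite mul0mx.
have : (z *m N) *m (z *m N)^T = 0.
  by rewrite trmx_mul mulmxA -(mulmxA z) zN mul0mx.
move=> /matrixP/(_ 0 0); rewrite mxE [RHS]mxE => /eqP.
rewrite psumr_eq0 => [/allP H|i _]; last by rewrite [X in _ * X]mxE -expr2 sqr_ge0.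
apply/rowP => i; rewrite [RHS]mxE; apply/eqP.
by have := H i (mem_index_enum i); rewrite /= [X in _ * X]mxE -expr2 sqrf_eq0.
Qed.

Lemma kernel_basis {R : realType} m (G : 'M[R]_(m, m.+2)) : row_free G ->
  exists N : 'M[R]_(2, m.+2), [/\ row_free N, N *m G^T = 0 &
    forall x : 'rV_m.+2, x *m G^T = 0 -> exists z : 'rV_2, x = z *m N].
Proof.
move=> Gf; have rk : \rank (kermx G^T) = 2%N.
  by rewrite mxrank_ker mxrank_tr (eqP Gf) -addn2 addnC addnK.
have [N [N1 N2 N3]] : exists N : 'M[R]_(\rank (kermx G^T), m.+2),
    [/\ row_free N, N *m G^T = 0 &
      forall x : 'rV_m.+2, x *m G^T = 0 -> exists z : 'rV__, x = z *m N].
  exists (row_base (kermx G^T)); split; first exact: row_base_free.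
    by apply/sub_kermxP; rewrite eq_row_base.
  by move=> x /sub_kermxP; rewrite -(eq_row_base (kermx _)) => /submxP.
by move: N N1 N2 N3; rewrite rk => N *; exists N.
Qed.

(** The rows of [G *m invmx A] are [A]-orthogonal to those of [N], because [N *m G^T = 0]. In the
    joint basis [S] the form is therefore block diagonal, with blocks [N *m A *m N^T] and
    [G *m invmx A *m G^T]; taking determinants and multiplying by det A leaves the square (det A det
    S)^2. *)
Lemma compression_det {R : realType} m (G : 'M[R]_(m, m.+2)) (N : 'M[R]_(2, m.+2))
    (A : 'M[R]_m.+2) :
  row_free N -> N *m G^T = 0 -> A^T = A -> \det A != 0 ->
  \det (G *m invmx A *m G^T) != 0 ->
  0 < \det A * \det (G *m invmx A *m G^T) * \det (N *m A *m N^T).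
Proof.
move=> Nf NG AT A0 g0; have Au : A \in unitmx by rewrite unitmxE unitfE.
have GN : G *m N^T = 0 by rewrite -[G]trmxK -trmx_mul NG trmx0.
pose S : 'M[R]_(2 + m) := col_mx N (G *m invmx A).
have AiT : (invmx A)^T = invmx A by rewrite trmx_inv AT.
have E1 : S *m A *m S^T = block_mx (N *m A *m N^T) 0 0 (G *m invmx A *m G^T).
  have -> : S *m A = col_mx (N *m A) G.
    by rewrite mul_col_mx (mulmxKV Au).
  rewrite tr_col_mx mul_col_row trmx_mul AiT GN mulmxA (mulmxK Au) NG.
  by rewrite mulmxA.
(* Invertibility of [S] is read off the product with [Q], which is block triangular with the Gram
   matrix of [N] and [G *m invmx A *m G^T] on the diagonal. *)
pose Q : 'M[R]_(2 + m) := row_mx N^T G^T.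
have E2 : S *m Q = block_mx (N *m N^T) 0 (G *m invmx A *m N^T) (G *m invmx A *m G^T).
  by rewrite /S /Q mul_col_row NG.
have S0 : \det S != 0.
  have : \det (S *m Q) != 0.
    rewrite E2 det_lblock mulf_neq0//.
    by have := gram_unitmx Nf; rewrite unitmxE unitfE.
  by rewrite det_mulmx mulf_eq0 negb_or => /andP[].
have := congr1 determinant E1; rewrite det_ublock !det_mulmx det_tr => E.
rewrite -mulrA (mulrC (\det (G *m _ *m _))) -E.
have -> : \det A * (\det S * \det A * \det S) = (\det A * \det S) ^+ 2 by ring.
by rewrite exprn_even_gt0//= mulf_neq0.
Qed.

(** * Conjugate frames of the plane ker G and the norm bounds they give *)

Section frame.
Context {R : realType} {m : nat}.
Notation V := 'rV[R]_m.+2.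
Variables (G : 'M[R]_(m, m.+2)) (A : 'M[R]_m.+2).
Hypotheses (Gf : row_free G) (AT : A^T = A).

Lemma dotpDl (u v w : V) : dotp (u + v) w = dotp u w + dotp v w.
Proof. by rewrite dotpC dotpDr !(dotpC w). Qed.

Lemma dotpZl k (u v : V) : dotp (k *: u) v = k * dotp u v.
Proof. by rewrite dotpC dotpZr dotpC. Qed.

Lemma dotp_sym (u v : V) : dotp (u *m A) v = dotp (v *m A) u.
Proof. by rewrite dotpC /dotp trmx_mul AT mulmxA. Qed.

Lemma conjugate_frame : \det A != 0 -> \det (G *m invmx A *m G^T) != 0 ->
  exists u v : V, [/\ u *m G^T = 0, v *m G^T = 0, dotp (u *m A) v = 0,
    0 < \det A * \det (G *m invmx A *m G^T) * (dotp (u *m A) u * dotp (v *m A) v) &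
    forall x : V, x *m G^T = 0 -> exists s t, x = s *: u + t *: v].
Proof.
move=> A0 g0; have [N [Nf NG span]] := kernel_basis Gf.
have := compression_det Nf NG AT A0 g0.
set D := \det A * _; rewrite det_mx2 => D0.
pose n1 := row 0 N; pose n2 := row 1 N.
have BE i j : (N *m A *m N^T) i j = dotp (row i N *m A) (row j N).
  by rewrite dotpE -row_mul mxE; apply: eq_bigr => k _; rewrite !mxE.
move: D0; rewrite !BE -/n1 -/n2 (dotp_sym n2 n1).
set p := dotp (n1 *m A) n1; set q := dotp (n1 *m A) n2; set r := dotp (n2 *m A) n2 => D0.
have [|x [y [z [w [d0 orth]]]]] := @diagonalize2 R p q r.
  by apply: contraTneq D0 => e; rewrite expr2 in e; rewrite e mulr0 ltxx.
have bil a b c d : dotp ((a *: n1 + b *: n2) *m A) (c *: n1 + d *: n2) =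
    a * c * p + (a * d + b * c) * q + b * d * r.
  rewrite mulmxDl -!scalemxAl dotpDl !dotpDr !dotpZl !dotpZr (dotp_sym n2 n1) -/p -/q -/r.
  by ring.
have nG i : row i N *m G^T = 0 by rewrite -row_mul NG row0.
exists (x *: n1 + y *: n2), (z *: n1 + w *: n2); split.
- by rewrite mulmxDl -!scalemxAl !nG !scaler0 addr0.
- by rewrite mulmxDl -!scalemxAl !nG !scaler0 addr0.
- by rewrite bil.
- rewrite !bil.
  (* The Gram determinant changes by the square of the determinant of the base change, so the
     product of the two diagonal values keeps the sign of p r - q^2. *)
  have -> : (x * x * p + (x * y + y * x) * q + y * y * r) *
    (z * z * p + (z * w + w * z) * q + w * w * r) =
    (x * w - y * z) ^+ 2 * (p * r - q * q) +
    (x * z * p + (x * w + y * z) * q + y * w * r) ^+ 2 by ring.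
  rewrite orth expr0n addr0 mulrCA mulr_gt0//.
  by rewrite exprn_even_gt0.
move=> xi /span[c ->].
have -> : c *m N = c 0 0 *: n1 + c 0 1 *: n2.
  rewrite mulmx_sum_row !big_ord_recl big_ord0 addr0.
  by rewrite (_ : lift ord0 ord0 = 1 :> 'I_2)//; exact/val_inj.
(* Cramer's rule for the base change. *)
exists ((c 0 0 * w - c 0 1 * z) / (x * w - y * z)),
  ((c 0 1 * x - c 0 0 * y) / (x * w - y * z)).
rewrite !scalerDr !scalerA addrACA -!scalerDl.
by congr (_ *: _ + _ *: _); field.
Qed.

Definition mx_bound k l (B : 'M[R]_(k, l)) : R := \sum_i \sum_j `|B i j|.

Lemma mx_bound_ge0 k l (B : 'M[R]_(k, l)) : 0 <= mx_bound B.
Proof. by apply: sumr_ge0 => i _; apply: sumr_ge0. Qed.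

Lemma ler_norm_mulmx k l (x : 'rV[R]_k) (B : 'M[R]_(k, l)) :
  `|x *m B| <= mx_bound B * `|x|.
Proof.
apply: ler_row_norm => [|j]; first by rewrite mulr_ge0// mx_bound_ge0.
rewrite mxE (le_trans (ler_norm_sum _ _ _))// /mx_bound mulr_suml ler_sum// => i _.
rewrite normrM mulrC ler_pM//; last exact: ler_coord_norm.
by rewrite (bigD1 j)//= lerDl sumr_ge0.
Qed.

Lemma ler_norm_quadratic k (x : 'rV[R]_k) (B : 'M[R]_k) :
  `|dotp (x *m B) x| <= k%:R * mx_bound B * `|x| ^+ 2.
Proof.
rewrite (le_trans (ler_norm_dotp _ _))// expr2 mulrA ler_wpM2r//.
rewrite -mulrA -[k in k%:R]card_ord -sumr_const mulr_suml ler_sum// => i _.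
by rewrite mul1r (le_trans (ler_coord_norm _ _))// ler_norm_mulmx.
Qed.

Variables (u v : V).
Let alpha := dotp (u *m A) u.
Let beta := dotp (v *m A) v.
Hypotheses (uG : u *m G^T = 0) (vG : v *m G^T = 0) (uv : dotp (u *m A) v = 0)
  (alpha0 : alpha != 0) (beta0 : beta != 0)
  (span : forall x : V, x *m G^T = 0 -> exists s t, x = s *: u + t *: v).

Lemma frame_inj (x : V) :
  x *m G^T = 0 -> dotp (u *m A) x = 0 -> dotp (v *m A) x = 0 -> x = 0.
Proof.
move=> /span[s [t ->]]; rewrite !dotpDr !dotpZr uv dotp_sym uv !mulr0 addr0 add0r.
move=> /eqP; rewrite mulf_eq0 (negbTE alpha0) orbF => /eqP->.
move=> /eqP; rewrite mulf_eq0 (negbTE beta0) orbF => /eqP->.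
by rewrite !scale0r addr0.
Qed.

(** By [frame_inj] the linear map x -> (<uA, x>, <vA, x>, x G^T) is injective, so a right inverse of
    its matrix [T] recovers [x] with a bounded factor. *)
Lemma frame_bound : exists2 K : R, 0 < K &
  forall x : V, `|x| <= K * (`|dotp (u *m A) x| + `|dotp (v *m A) x| + `|x *m G^T|).
Proof.
pose T := row_mx (A *m u^T) (row_mx (A *m v^T) G^T).
have TE (x : V) w : x *m (A *m w^T) = (dotp (w *m A) x)%:M.
  apply/rowP => i; rewrite (ord1 i) [RHS]mxE eqxx mulr1n.
  by rewrite dotpC /dotp trmx_mul AT.
have Tf : row_free T.
  apply: inj_row_free => x; rewrite /T !mul_mx_row !TE.
  move=> /eqP; rewrite row_mx_eq0 row_mx_eq0 => /and3P[/eqP a /eqP b /eqP c].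
  apply: frame_inj => //.
    by move/matrixP: a => /(_ 0 0); rewrite !mxE eqxx.
  by move/matrixP: b => /(_ 0 0); rewrite !mxE eqxx.
have /row_freeP[B TB] := Tf.
exists (mx_bound B + 1); first by rewrite ltr_wpDl// mx_bound_ge0.
move=> x; rewrite -{1}[x]mulmx1 -TB mulmxA (le_trans (ler_norm_mulmx _ _))//.
apply: ler_pM => //; [exact: mx_bound_ge0|by rewrite lerDl|].
rewrite /T !mul_mx_row !TE; apply: ler_row_norm; first by rewrite !addr_ge0.
move=> i; rewrite mxE; case: split_ordP => j _.
  by rewrite (ord1 j) mxE eqxx mulr1n -addrA lerDl addr_ge0.
rewrite mxE; case: split_ordP => k _.
  by rewrite (ord1 k) mxE eqxx mulr1n addrAC lerDr addr_ge0.
by rewrite (le_trans (ler_coord_norm _ _))// lerDr addr_ge0.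
Qed.

(* The [A]-orthogonal projection of [x] along the span of [u] and [v]: it has the same
   image under [G^T] as [x], hence is controlled by that image. *)
Let residue (x : V) : V :=
  x - (dotp (u *m A) x / alpha) *: u - (dotp (v *m A) x / beta) *: v.

Let dotpBr (w x y : V) : dotp w (x - y) = dotp w x - dotp w y.
Proof. by rewrite -scaleN1r dotpDr dotpZr mulN1r. Qed.

Let residue_u x : dotp (u *m A) (residue x) = 0.
Proof. by rewrite /residue !dotpBr !dotpZr uv -/alpha mulr0 subr0 divfK// subrr. Qed.

Let residue_v x : dotp (v *m A) (residue x) = 0.
Proof.
by rewrite /residue !dotpBr !dotpZr (dotp_sym v u) uv -/beta mulr0 subr0 divfK// subrr.
Qed.

Let residueE (x : V) :
  x = residue x + (dotp (v *m A) x / beta) *: v + (dotp (u *m A) x / alpha) *: u.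
Proof. by rewrite /residue subrK subrK. Qed.

(** Pythagoras for [A] along [u], [v] and the residue: the left side is the form at the residue. Its
    two frame coordinates vanish, so [frame_bound] controls it by the image under [G^T] alone. *)
Lemma frame_quadratic : exists2 K : R, 0 <= K & forall x : V,
  `|dotp (x *m A) x - dotp (u *m A) x ^+ 2 / alpha - dotp (v *m A) x ^+ 2 / beta|
  <= K * `|x *m G^T| ^+ 2.
Proof.
have [K K0 hK] := frame_bound.
pose c : R := m.+2%:R * mx_bound A; have c0 : 0 <= c by rewrite mulr_ge0// mx_bound_ge0.
exists (c * K ^+ 2); first by rewrite mulr_ge0// sqr_ge0.
move=> x.
have -> : dotp (x *m A) x - dotp (u *m A) x ^+ 2 / alpha - dotp (v *m A) x ^+ 2 / beta
   = dotp (residue x *m A) (residue x).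
  have E (r : V) a b : dotp (u *m A) r = 0 -> dotp (v *m A) r = 0 ->
      dotp ((r + b *: v + a *: u) *m A) (r + b *: v + a *: u) =
      dotp (r *m A) r + b ^+ 2 * beta + a ^+ 2 * alpha.
    move=> ru rv; rewrite !mulmxDl -!scalemxAl !dotpDl !dotpDr !dotpZl !dotpZr.
    by rewrite (dotp_sym r u) (dotp_sym r v) ru rv (dotp_sym v u) uv /alpha /beta; ring.
  have := E _ (dotp (u *m A) x / alpha) (dotp (v *m A) x / beta) (residue_u x) (residue_v x).
  rewrite -residueE => ->.
  by field; rewrite alpha0 beta0.
rewrite (le_trans (ler_norm_quadratic _ _))// -/c -mulrA -exprMn ler_wpM2l//.
rewrite lerXn2r ?nnegrE ?mulr_ge0 ?(ltW K0)//.
have := hK (residue x); rewrite residue_u residue_v normr0 !add0r.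
suff -> : residue x *m G^T = x *m G^T by [].
by rewrite /residue !mulmxBl -!scalemxAl uG vG !scaler0 !subr0.
Qed.

End frame.

(** * Determinants with two free rows below the rows of G *)

Section stack.
Context {R : realType} {m : nat}.
Notation V := 'rV[R]_m.+2.

(** Same row order as [jac_rows], with both last rows free: the determinant becomes an alternating
    bilinear form in [(w, w')] which vanishes as soon as one argument is a row of [G]. *)
Definition stack (G : 'M[R]_(m, m.+2)) (w w' : V) : 'M[R]_m.+2 :=
  \matrix_(k, j) match (insub (k : nat) : option 'I_m) with
    | Some k' => G k' j
    | None => if k == m :> nat then w 0 j else w' 0 j
    end.

Definition penultimate : 'I_m.+2 := Ordinal (leqnSn m.+1).

Definition casimir_index (k : 'I_m) : 'I_m.+2 := widen_ord (leqW (leqnSn m)) k.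

Implicit Types (G : 'M[R]_(m, m.+2)) (w x : V).

Lemma row_stack_casimir G w w' k : row (casimir_index k) (stack G w w') = row k G.
Proof.
apply/rowP => j; rewrite !mxE; case: insubP => [k' _ kk'|]; last by rewrite /= ltn_ord.
by congr (G _ _); exact/val_inj.
Qed.

Lemma row_stack_penultimate G w w' : row penultimate (stack G w w') = w.
Proof.
apply/rowP => j; rewrite !mxE; case: insubP => [k' /=|_]; first by rewrite ltnn.
by rewrite eqxx.
Qed.

Lemma row_stack_max G w w' : row ord_max (stack G w w') = w'.
Proof.
apply/rowP => j; rewrite !mxE; case: insubP => [k' /=|_ /=]; first by rewrite ltnNge leqW.
by rewrite gtn_eqF.
Qed.

Lemma stack_indexP (k : 'I_m.+2) :
  [\/ exists k', k = casimir_index k', k = penultimate | k = ord_max].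
Proof.
have [km|] := ltnP k m; first by constructor 1; exists (Ordinal km); exact/val_inj.
rewrite leq_eqVlt => /predU1P[mk|mk]; first by constructor 2; exact/val_inj.
constructor 3; apply/val_inj/eqP; rewrite /= eqn_leq mk andbT.
by rewrite -ltnS ltn_ord.
Qed.

(** The cofactors along a row do not see that row, so it may be set to 0 in them; this exhibits
    linearity in [w'] with coefficients depending on [G] and [w] only. *)
Lemma det_stack_last G w w' :
  \det (stack G w w') = dotp w' (\row_j cofactor (stack G w 0) ord_max j).
Proof.
rewrite (expand_det_row _ ord_max) dotpE; apply: eq_bigr => j _.
have /rowP/(_ j) := row_stack_max G w w'; rewrite mxE => ->; rewrite mxE.
congr (_ * (_ * \det _)); apply/matrixP => k l; rewrite !mxE.
case: insubP => //; rewrite -leqNgt lift_max => mk.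
by rewrite eqn_leq mk -ltnS ltn_ord.
Qed.

Lemma det_stack_penultimate G w w' :
  \det (stack G w w') = dotp w (\row_j cofactor (stack G 0 w') penultimate j).
Proof.
rewrite (expand_det_row _ penultimate) dotpE; apply: eq_bigr => j _.
have /rowP/(_ j) := row_stack_penultimate G w w'; rewrite mxE => ->; rewrite mxE.
congr (_ * (_ * \det _)); apply/matrixP => k l; rewrite !mxE.
case: insubP => // _.
case: ifP => // /eqP km; exfalso.
by move: (neq_lift penultimate k) => /eqP; apply; apply/val_inj; exact: esym km.
Qed.

Lemma det_stack_eq G w : \det (stack G w w) = 0.
Proof.
apply: (determinant_alternate (i1 := penultimate) (i2 := ord_max)).
  by rewrite -val_eqE /= ltn_eqF.
by move=> j; move: (row_stack_penultimate G w w) (row_stack_max G w w) =>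
  /rowP/(_ j) + /rowP/(_ j); rewrite ![row _ _ _ _]mxE => -> ->.
Qed.

Lemma det_stack_penultimate_row G w' k : \det (stack G (row k G) w') = 0.
Proof.
apply: (determinant_alternate (i1 := casimir_index k) (i2 := penultimate)).
  by rewrite -val_eqE /= ltn_eqF.
by move=> j; move: (row_stack_casimir G (row k G) w' k) (row_stack_penultimate G (row k G) w') =>
  /rowP/(_ j) + /rowP/(_ j); rewrite ![row _ (stack _ _ _) _ _]mxE => -> ->.
Qed.

Lemma det_stack_last_row G w k : \det (stack G w (row k G)) = 0.
Proof.
apply: (determinant_alternate (i1 := casimir_index k) (i2 := ord_max)).
  by rewrite -val_eqE /= ltn_eqF// leqW.
by move=> j; move: (row_stack_casimir G w (row k G) k) (row_stack_max G w (row k G)) =>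
  /rowP/(_ j) + /rowP/(_ j); rewrite ![row _ (stack _ _ _) _ _]mxE => -> ->.
Qed.

Lemma stack_mul_eq0 G w w' x :
  reflect [/\ x *m G^T = 0, dotp w x = 0 & dotp w' x = 0] (x *m (stack G w w')^T == 0).
Proof.
have E k : (x *m (stack G w w')^T) 0 k = dotp (row k (stack G w w')) x.
  by rewrite dotpC dotpE mxE; apply: eq_bigr => j _; rewrite !mxE.
have EG k : (x *m G^T) 0 k = dotp (row k G) x.
  by rewrite dotpC dotpE mxE; apply: eq_bigr => j _; rewrite !mxE.
apply: (iffP eqP) => [/rowP h|[/rowP h1 h2 h3]].
  split.
  - by apply/rowP => k; rewrite EG -(row_stack_casimir G w w') -E h !mxE.
  - by rewrite -(row_stack_penultimate G w w') -E h mxE.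
  - by rewrite -(row_stack_max G w w') -E h mxE.
apply/rowP => k; rewrite E [RHS]mxE; have [[k' ->]|->|->] := stack_indexP k.
- by rewrite row_stack_casimir -EG h1 mxE.
- by rewrite row_stack_penultimate.
- by rewrite row_stack_max.
Qed.

Lemma det_stack_eq0 G w w' x : x != 0 ->
  x *m G^T = 0 -> dotp w x = 0 -> dotp w' x = 0 -> \det (stack G w w') = 0.
Proof.
move=> x0 h1 h2 h3; apply/eqP; apply: contraNT x0.
rewrite -det_tr -unitfE -unitmxE -row_free_unit => /row_free_inj inj.
by apply/eqP/inj; rewrite mul0mx; apply/eqP/stack_mul_eq0.
Qed.

Lemma det_stack_neq0 G w w' :
  (forall x, x *m G^T = 0 -> dotp w x = 0 -> dotp w' x = 0 -> x = 0) ->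
  \det (stack G w w') != 0.
Proof.
move=> inj; rewrite -det_tr -unitfE -unitmxE -row_free_unit.
by apply: inj_row_free => x /eqP/stack_mul_eq0[? ? ?]; exact: inj.
Qed.

End stack.

Section frame_stack.
Context {R : realType} {m : nat}.
Notation V := 'rV[R]_m.+2.
Implicit Types (G : 'M[R]_(m, m.+2)) (A : 'M[R]_m.+2) (u v w x : V).

Lemma det_stackDr G w x y k l :
  \det (stack G w (k *: x + l *: y)) = k * \det (stack G w x) + l * \det (stack G w y).
Proof. by rewrite !det_stack_last dotpDl !dotpZl. Qed.

Lemma det_stackDl G w x y :
  \det (stack G (x + y) w) = \det (stack G x w) + \det (stack G y w).
Proof. by rewrite !det_stack_penultimate dotpDl. Qed.

Lemma det_stackC G x y : \det (stack G x y) = - \det (stack G y x).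
Proof.
have := det_stack_eq G (x + y); rewrite det_stackDl.
have D w : \det (stack G w (x + y)) = \det (stack G w x) + \det (stack G w y).
  by rewrite -[x]scale1r -[y]scale1r det_stackDr !mul1r !scale1r.
by rewrite !D !det_stack_eq addr0 add0r => /eqP; rewrite addr_eq0 => /eqP.
Qed.

(** Removing from [x] its component along [v] leaves an [r] with <rA, v> = 0. Then [v] is orthogonal
    to every row of the stack with last rows [u *m A] and [r *m A], so that determinant vanishes and
    only the [v] component counts. *)
Lemma det_stack_frame G A u v x : A^T = A ->
  u *m G^T = 0 -> v *m G^T = 0 -> dotp (u *m A) v = 0 ->
  dotp (u *m A) u != 0 -> dotp (v *m A) v != 0 ->
  \det (stack G (u *m A) (x *m A)) =
  dotp (v *m A) x / dotp (v *m A) v * \det (stack G (u *m A) (v *m A)).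
Proof.
move=> AT uG vG uv; set alpha := dotp _ u; set beta := dotp _ v => al be.
have v0 : v != 0.
  apply: contraNneq be => v0; rewrite /beta /dotp v0 trmx0 mulmx0 mxE; exact: eqxx.
pose r := x - (dotp (v *m A) x / beta) *: v.
have -> : x *m A = 1 *: (r *m A) + (dotp (v *m A) x / beta) *: (v *m A).
  by rewrite scale1r /r mulmxBl -scalemxAl subrK.
rewrite det_stackDr mul1r (det_stack_eq0 v0) ?add0r//.
rewrite (dotp_sym AT) /r -scaleN1r dotpDr !dotpZr -/beta divfK// mulN1r subrr //.
Qed.

Lemma mulmx_sym_coord k (A : 'M[R]_k) (x : 'rV[R]_k) j :
  A^T = A -> (x *m A) 0 j = dotp (row j A) x.
Proof.
move=> AT; rewrite dotpE mxE; apply: eq_bigr => i _; rewrite [in RHS]mxE mulrC.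
by congr (_ * _); rewrite -[in RHS]AT [RHS]mxE.
Qed.

End frame_stack.

(** * Exit times, truncation and first-order expansions *)

Lemma continuous_ball {R : realType} (V W : normedModType R) (f : V -> W) (x : V) (e : R) :
  {for x, continuous f} -> 0 < e ->
  exists2 d : R, 0 < d & forall y, `|y - x| < d -> `|f x - f y| < e.
Proof. by move=> cf e0; apply/near_ballP; exact: (cvgr_dist_lt _ _ cf _ e0). Qed.

Lemma ball_continuous {R : realType} (V W : normedModType R) (f : V -> W) (x : V) :
  (forall e : R, 0 < e ->
    exists2 d : R, 0 < d & forall y, `|y - x| < d -> `|f x - f y| < e) ->
  {for x, continuous f}.
Proof. by move=> H; apply/cvgrPdist_lt => e e0; apply/near_ballP; exact: H. Qed.

(** The time is the infimum of the set where [rho <= h]. By continuity [h] is not below [rho] there,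
    since the set comes arbitrarily close, nor above, since all earlier values are below [rho]. *)
Lemma first_exit {R : realType} (h : R -> R) (t rho : R) : 0 <= t ->
  (forall s : R, 0 <= s <= t -> {for s, continuous h}) -> h 0 < rho -> rho <= h t ->
  exists s, [/\ 0 <= s <= t, h s = rho & forall s', 0 <= s' <= s -> h s' <= rho].
Proof.
move=> t0 ch h0 ht; pose S := [set s | 0 <= s <= t /\ rho <= h s].
have St : S t by split=> //; rewrite t0 lexx.
have infS : has_inf S by split; [exists t|exists 0 => s [/andP[]]].
have lbS s : S s -> inf S <= s by move=> Ss; apply: ge_inf => //; case: infS.
have i0 : 0 <= inf S by apply: lb_le_inf; [exists t|move=> s [/andP[]]].
have it : inf S <= t by exact: lbS.
have below s : 0 <= s < inf S -> h s < rho.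
  move=> /andP[s0 si]; rewrite ltNge; apply/negP => hs.
  suff : S s by move=> /lbS; rewrite leNgt si.
  by split=> //; rewrite s0 (le_trans (ltW si)).
have hc : {for inf S, continuous h} by apply: ch; rewrite i0.
have h1 : rho <= h (inf S).
  rewrite leNgt; apply/negP => hr.
  have e0 : 0 < rho - h (inf S) by rewrite subr_gt0.
  have [d d0 hd] := continuous_ball hc e0.
  have [s [s0t hs] sd] := inf_adherent d0 infS.
  have H : `|h (inf S) - h s| < rho - h (inf S).
    by apply: hd; rewrite ger0_norm ?subr_ge0 ?lbS// ltrBlDl.
  move: H; rewrite distrC => /(le_lt_trans (ler_norm _)); lra.
have h2 : h (inf S) <= rho.
  rewrite leNgt; apply/negP => hr.
  have e0 : 0 < h (inf S) - rho by rewrite subr_gt0.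
  have [d d0 hd] := continuous_ball hc e0.
  have ip : 0 < inf S.
    by rewrite lt_neqAle i0 andbT; apply: contraTneq hr => <-; rewrite -leNgt ltW.
  pose s := Num.max 0 (inf S - d / 2).
  have s0 : 0 <= s by rewrite /s le_max lexx.
  have sd : inf S - d / 2 <= s by rewrite /s le_max lexx orbT.
  have si : s < inf S by rewrite /s gt_max ip; lra.
  have hs : h s < rho by apply: below; rewrite s0.
  have := hd s; rewrite ltr0_norm ?subr_lt0// => H.
  have /(le_lt_trans (ler_norm _)) : `|h (inf S) - h s| < h (inf S) - rho.
    by apply: H; lra.
  lra.
exists (inf S); split; first by rewrite i0.
  by apply/eqP; rewrite eq_le h2.
move=> s /andP[s0]; rewrite le_eqVlt => /predU1P[->//|si].
by rewrite ltW// below// s0.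
Qed.

Section clamp.
Context {R : realType} {n : nat}.
Variables (x0 : 'rV[R]_n) (rho : R).
Hypothesis rho0 : 0 <= rho.

(** For the sup norm the closed ball is a cube, so truncating coordinates is a retraction onto it
    that does not increase distances. *)
Definition clamp (x : 'rV[R]_n) : 'rV[R]_n :=
  x0 + \row_i Num.max (- rho) (Num.min rho (x 0 i - x0 0 i)).

Lemma clamp_ball x : `|clamp x - x0| <= rho.
Proof.
rewrite /clamp addrC addKr; apply: ler_row_norm => // i; rewrite mxE ler_norml.
rewrite le_max lexx /= ge_max ge_min lexx /= andbT; move: rho0; lra.
Qed.

Lemma clamp_id x : `|x - x0| <= rho -> clamp x = x.
Proof.
move=> xr; apply/rowP => i; rewrite !mxE.
have := le_trans (ler_coord_norm (x - x0) i) xr; rewrite !mxE ler_norml => /andP[h1 h2].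
by rewrite min_r// max_r// addrC subrK.
Qed.

Lemma clamp_lipschitz x y : `|clamp x - clamp y| <= `|x - y|.
Proof.
apply: ler_row_norm => // i; rewrite !mxE.
have := ler_coord_norm (x - y) i; rewrite !mxE; apply: le_trans.
rewrite opprD addrACA subrr add0r.
have {1}-> : x 0 i - y 0 i = (x 0 i - x0 0 i) - (y 0 i - x0 0 i) by ring.
move: (x 0 i - x0 0 i) (y 0 i - x0 0 i) => a b.
have := ler_norm (a - b); have := ler_norm (b - a); rewrite (distrC b).
move: rho0 `|a - b| => r0 N h1 h2; rewrite ler_norml /Num.max /Num.min.
case: (ltP rho a) => ?; case: (ltP rho b) => ?.
all: case: ltP => ?; case: ltP => ?; apply/andP; split; lra.
Qed.

End clamp.

Section expands.
Context {R : realType} {n : nat}.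
Notation V := 'rV[R]_n.
Implicit Types (f : V -> R) (g x y : V).

(** The case [y = x] forces [f x = 0]. For such functions a locally Lipschitz factor enters the
    linear part only through its value at [x], as [expandsM] shows, so products need no derivative
    of that factor. *)
Definition expands x f g := forall e : R, 0 < e -> exists2 r : R, 0 < r &
  forall y, `|y - x| < r -> `|f y - dotp g (y - x)| <= e * `|y - x|.

Lemma differentiable_expands x f : differentiable f x ->
  expands x (fun y => f y - f x) (grad f x).
Proof. by move=> df e; exact: grad_expansion. Qed.

Lemma expands0 x : expands x (fun=> 0) 0.
Proof.
move=> e e0; exists 1 => // y _.
by rewrite /dotp mul0mx mxE subrr normr0 mulr_ge0// ltW.
Qed.

Lemma expandsD x f1 f2 g1 g2 : expands x f1 g1 -> expands x f2 g2 ->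
  expands x (fun y => f1 y + f2 y) (g1 + g2).
Proof.
move=> h1 h2 e e0; have e2 : 0 < e / 2 by rewrite divr_gt0.
have [r1 r10 H1] := h1 _ e2; have [r2 r20 H2] := h2 _ e2.
exists (Num.min r1 r2); first by rewrite lt_min r10.
move=> y; rewrite lt_min => /andP[y1 y2].
rewrite dotpC dotpDr !(dotpC (y - x)) opprD addrACA (le_trans (ler_normD _ _))//.
have -> : e * `|y - x| = e / 2 * `|y - x| + e / 2 * `|y - x| by rewrite -mulrDl -splitr.
by rewrite lerD// ?H1 ?H2.
Qed.

Lemma expands_sum (I : Type) (s : seq I) (F : I -> V -> R) (g : I -> V) x :
  (forall i, expands x (F i) (g i)) ->
  expands x (fun y => \sum_(i <- s) F i y) (\sum_(i <- s) g i).
Proof.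
move=> HF; elim: s => [|i s IH].
  by rewrite big_nil; under eq_fun do rewrite big_nil; exact: expands0.
by rewrite big_cons; under eq_fun do rewrite big_cons; exact: expandsD.
Qed.

Lemma expandsM x f1 f2 g : locally_lipschitz x f1 -> expands x f2 g ->
  expands x (fun y => f1 y * f2 y) (f1 x *: g).
Proof.
move=> /locally_lipschitz_bounded[r1 [K [M [r10 K0 M0 H1]]]] h2 e e0.
pose c := \sum_i `|g 0 i|; have c0 : 0 <= c by rewrite sumr_ge0.
have M1 : 0 < M + 1 by rewrite ltr_wpDl.
have c1 : 0 < K * c + 1 by rewrite ltr_wpDl// mulr_ge0.
have e2 : 0 < e / 2 / (M + 1) by rewrite !divr_gt0.
have [r2 r20 H2] := h2 _ e2.
pose r3 := e / 2 / (K * c + 1); have r30 : 0 < r3 by rewrite !divr_gt0.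
exists (Num.min r1 (Num.min r2 r3)); first by rewrite !lt_min r10 r20.
move=> y; rewrite !lt_min => /and3P[y1 y2 y3].
have x1 : `|x - x| < r1 by rewrite subrr normr0.
have [L B] := H1 _ _ y1 x1.
have -> : f1 y * f2 y - dotp (f1 x *: g) (y - x) =
    f1 y * (f2 y - dotp g (y - x)) + (f1 y - f1 x) * dotp g (y - x).
  by rewrite (dotpC (_ *: _)) dotpZr dotpC; ring.
have -> : e * `|y - x| = e / 2 * `|y - x| + e / 2 * `|y - x| by rewrite -mulrDl -splitr.
rewrite (le_trans (ler_normD _ _))// !normrM lerD//.
  have -> : e / 2 = (M + 1) * (e / 2 / (M + 1)) by rewrite [RHS]mulrC divfK// gt_eqF.
  rewrite -mulrA ler_pM// ?H2//.
  by rewrite (le_trans B)// lerDl.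
have := ler_pM (normr_ge0 _) (normr_ge0 _) L (ler_norm_dotp g (y - x)).
move=> /le_trans; apply; rewrite -/c mulrA ler_wpM2r//.
rewrite mulrAC (@le_trans _ _ ((K * c + 1) * r3))//.
  by rewrite ler_pM// ?mulr_ge0 ?lerDl// ltW.
by rewrite /r3 mulrC divfK// gt_eqF.
Qed.

Lemma locally_lipschitz_det k (M : V -> 'M[R]_k) x :
  (forall i j, locally_lipschitz x (fun y => M y i j)) ->
  locally_lipschitz x (fun y => \det (M y)).
Proof.
move=> HM; apply: locally_lipschitz_sum => s _; apply: locally_lipschitzM.
  exact: locally_lipschitz_cst.
by apply: locally_lipschitz_prod => i; exact: HM.
Qed.

Lemma locally_lipschitz_row x (X : V -> V) :
  (forall i, locally_lipschitz x (fun y => X y 0 i)) ->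
  exists r K : R, [/\ 0 < r, 0 <= K &
    forall y z, `|y - x| < r -> `|z - x| < r -> `|X y - X z| <= K * `|y - z|].
Proof.
move=> /choice[r /choice[K H]].
have Kn i : 0 <= K i by case: (H i).
exists (\big[Num.min/1]_i r i), (\sum_i K i); split.
- by apply/bigmin_gtP; split => // i _; case: (H i).
- by rewrite sumr_ge0.
move=> y z /bigmin_gtP[_ yr] /bigmin_gtP[_ zr]; apply: ler_row_norm.
  by rewrite mulr_ge0// sumr_ge0.
move=> i; rewrite !mxE; have [_ _ Hi] := H i.
rewrite (le_trans (Hi _ _ (yr i isT) (zr i isT)))// ler_wpM2r//.
by rewrite (bigD1 i)//= lerDl sumr_ge0.
Qed.

End expands.

(** * The Hamiltonian vector field and its linearization *)

Section smooth.
Context {R : realType} {n : nat}.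
Notation V := 'rV[R]_n.
Variable O : set V.
Hypothesis openO : open O.
Implicit Types (f : V -> R) (x : V).

Lemma smooth_differentiable f x : smooth_on O f -> O x -> differentiable f x.
Proof. by move=> /(_ [::] x). Qed.

Lemma smooth_partial i f : smooth_on O f -> smooth_on O (partial i f).
Proof.
(* The last vector of the list is differentiated first, so a partial derivative is appended at the
   end. *)
move=> sf vs x Ox; have := sf (rcons vs (basis_vec R i)) x Ox.
suff -> : iter_deriv (rcons vs (basis_vec R i)) f = iter_deriv vs (partial i f) by [].
by elim: vs => //= v vs ->.
Qed.

Lemma near_open x : O x -> \forall y \near x, O y.
Proof. by move=> Ox; apply: open_nbhs_nbhs. Qed.

Lemma smooth_locally_lipschitz f x : smooth_on O f -> O x -> locally_lipschitz x f.
Proof.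
move=> sf Ox; apply: C1_locally_lipschitz => [|i].
  by apply: filterS (near_open Ox) => y; exact: smooth_differentiable.
exact: differentiable_continuous (smooth_differentiable (@smooth_partial i _ sf) Ox).
Qed.

Lemma smooth_partialC f x i j : smooth_on O f -> O x ->
  partial j (partial i f) x = partial i (partial j f) x.
Proof.
move=> sf Ox; apply: partialC.
- by apply: filterS (near_open Ox) => y; exact: smooth_differentiable.
- exact: smooth_differentiable (@smooth_partial i _ sf) Ox.
- exact: smooth_differentiable (@smooth_partial j _ sf) Ox.
Qed.

End smooth.

Section F_lam.
Context {R : realType} {m : nat}.
Notation V := 'rV[R]_m.+2.
Variables (lam : 'I_m -> R).
Implicit Types (H : V -> R) (C : 'I_m -> V -> R) (x v : V).

Let F_lamE C H : F_lam C H lam = H + \sum_(k < m) lam k *: C k.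
Proof. by apply/funext => x; rewrite /F_lam fctE fct_sumE. Qed.

Lemma differentiable_F_lam C H x : differentiable H x ->
  (forall k, differentiable (C k) x) -> differentiable (F_lam C H lam) x.
Proof.
move=> dH dC; rewrite F_lamE; apply: differentiableD => //.
by apply: differentiable_sum => k; exact: differentiableZ.
Qed.

Lemma derive_F_lam C H x v : differentiable H x ->
  (forall k, differentiable (C k) x) ->
  'D_v (F_lam C H lam) x = 'D_v H x + \sum_(k < m) lam k * 'D_v (C k) x.
Proof.
move=> dH dC; rewrite F_lamE deriveD ?derive_sum.
- by congr (_ + _); apply: eq_bigr => k _; rewrite deriveZ//; exact: diff_derivable.
- by move=> k; apply: derivableZ; exact: diff_derivable.
- exact: diff_derivable.
- by apply: derivable_sum => k; apply: derivableZ; exact: diff_derivable.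
Qed.

Lemma grad_F_lam C H x : differentiable H x ->
  (forall k, differentiable (C k) x) ->
  grad (F_lam C H lam) x = grad H x + \sum_(k < m) lam k *: grad (C k) x.
Proof.
move=> dH dC; apply/rowP => i; rewrite !mxE summxE /partial derive_F_lam//.
by congr (_ + _); apply: eq_bigr => k _; rewrite !mxE.
Qed.

End F_lam.

Section system.
Context {R : realType} {m : nat}.
Notation V := 'rV[R]_m.+2.
Variables (O : set V) (nu : V -> R) (C : 'I_m -> V -> R) (H : V -> R).
Hypotheses (openO : open O) (snu : smooth_on O nu)
  (sC : forall k, smooth_on O (C k)) (sH : smooth_on O H).

Let X := vfield nu C H.
Local Notation G x := (rows_mx (fun k => grad (C k) x)).

Let rowG k x : row k (G x) = grad (C k) x.
Proof. by apply/rowP => j; rewrite !mxE. Qed.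

Lemma jac_rowsE i x : jac_rows C H i x = stack (G x) (basis_vec R i) (grad H x).
Proof. by apply/matrixP => k j; rewrite !mxE; case: insubP => //= k' _ _; rewrite !mxE. Qed.

Lemma dotp_vfield w x : dotp w (X x) = nu x * \det (stack (G x) w (grad H x)).
Proof.
rewrite det_stack_penultimate !dotpE mulr_sumr; apply: eq_bigr => i _.
rewrite [X x 0 i]mxE jac_rowsE det_stack_penultimate mulrCA; congr (_ * (_ * _)).
by rewrite dotpC dotp_basis.
Qed.

Lemma casimir_conserved k x : dotp (grad (C k) x) (X x) = 0.
Proof. by rewrite dotp_vfield -rowG det_stack_penultimate_row mulr0. Qed.

Lemma hamiltonian_conserved x : dotp (grad H x) (X x) = 0.
Proof. by rewrite dotp_vfield det_stack_eq mulr0. Qed.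

Lemma stack_locally_lipschitz (w w' : V -> V) x k j : O x ->
  (forall i, locally_lipschitz x (fun y => w y 0 i)) ->
  (forall i, locally_lipschitz x (fun y => w' y 0 i)) ->
  locally_lipschitz x (fun y => stack (G y) (w y) (w' y) k j).
Proof.
move=> Ox hw hw'; under eq_fun do rewrite mxE.
case: insubP => [k' _ _|_]; last by case: (_ == _).
under eq_fun do rewrite !mxE.
exact: (smooth_locally_lipschitz openO (@smooth_partial _ _ O j _ (sC k')) Ox).
Qed.

Lemma vfield_locally_lipschitz x : O x ->
  exists r K : R, [/\ 0 < r, 0 <= K &
    forall y z, `|y - x| < r -> `|z - x| < r -> `|X y - X z| <= K * `|y - z|].
Proof.
move=> Ox; apply: locally_lipschitz_row => i; under eq_fun do rewrite mxE jac_rowsE.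
apply: (@locally_lipschitzM _ _ x nu). exact (smooth_locally_lipschitz openO snu Ox).
apply: locally_lipschitz_det => k j; apply: stack_locally_lipschitz => // l.
  exact: locally_lipschitz_cst.
under eq_fun do rewrite mxE.
exact: (smooth_locally_lipschitz openO (@smooth_partial _ _ O l _ sH) Ox).
Qed.

Variables (xe : V) (lam : 'I_m -> R).
Hypotheses (Oxe : O xe) (crit : grad H xe + \sum_(k < m) lam k *: grad (C k) xe = 0).

Let F := F_lam C H lam.
Let A := hess F xe.
(** The i-th partial derivative of [F] on [O], written as another instance of [F_lam] so that the
    rules for [F_lam] apply to it again. *)
Local Notation dF i := (F_lam (fun k => partial i (C k)) (partial i H) lam).

Let dHx x : O x -> differentiable H x.
Proof. exact: smooth_differentiable. Qed.
Let dCx x k : O x -> differentiable (C k) x.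
Proof. exact: smooth_differentiable. Qed.
Let dpH x i : O x -> differentiable (partial i H) x.
Proof. by move=> Ox; exact (smooth_differentiable (@smooth_partial _ _ O i _ sH) Ox). Qed.
Let dpC x k i : O x -> differentiable (partial i (C k)) x.
Proof. by move=> Ox; exact (smooth_differentiable (@smooth_partial _ _ O i _ (sC k)) Ox). Qed.

Lemma partial_F_lam x i : O x -> partial i F x = dF i x.
Proof. by move=> Ox; rewrite /partial derive_F_lam => [//||k]; [exact: dHx|exact: dCx]. Qed.

Lemma hess_F_lamE i j : A i j = partial j (dF i) xe.
Proof.
rewrite mxE; apply: near_eq_derive; apply: filterS (near_open openO Oxe) => x.
exact: partial_F_lam.
Qed.

Let partial_dF i j : partial j (dF i) xe =
  partial j (partial i H) xe + \sum_(k < m) lam k * partial j (partial i (C k)) xe.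
Proof.
by rewrite [LHS]derive_F_lam => [//||k]; [exact (dpH i Oxe)|exact (dpC k i Oxe)].
Qed.

Lemma hess_F_lam_sym : A^T = A.
Proof.
apply/matrixP => i j; rewrite mxE !hess_F_lamE.
refine (etrans (partial_dF j i) (etrans _ (esym (partial_dF i j)))).
refine (f_equal2 _ (smooth_partialC openO j i sH Oxe) _).
apply: eq_bigr => k _.
exact (f_equal _ (smooth_partialC openO j i (sC k) Oxe)).
Qed.

Lemma dF_expands i : expands xe (dF i) (row i A).
Proof.
have dFe : dF i xe = 0.
  have /rowP/(_ i) := crit; rewrite !mxE summxE => <-; congr (_ + _).
  by apply: eq_bigr => k _; rewrite !mxE.
have ddF : differentiable (dF i) xe.
  by apply: differentiable_F_lam => [|k]; [exact: dpH|exact: dpC].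
have -> : row i A = grad (dF i) xe by apply/rowP => j; rewrite [LHS]mxE hess_F_lamE mxE.
have := differentiable_expands ddF; rewrite dFe.
by under eq_fun do rewrite subr0.
Qed.

(** The last row grad H may be replaced by grad F, which differs from it by rows of G. As grad F
    vanishes at [xe], the factor [nu] and the cofactors contribute only their values there, and the
    linear part of grad F is given by the Hessian. *)
Lemma vfield_expands w : exists2 g, expands xe (fun x => dotp w (X x)) g &
  forall z, dotp g z = nu xe * \det (stack (G xe) w (z *m A)).
Proof.
pose cof x j := cofactor (stack (G x) w 0) ord_max j.
exists (\sum_j (nu xe * cof xe j) *: row j A).
  have E x : O x -> dotp w (X x) = \sum_j (nu x * cof x j) * dF j x.
    move=> Ox; rewrite dotp_vfield det_stack_last.
    have -> : dotp (grad H x) (\row_j cofactor (stack (G x) w 0) ord_max j) =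
        dotp (grad F x) (\row_j cofactor (stack (G x) w 0) ord_max j).
      rewrite /F grad_F_lam; [|exact: dHx|by move=> k; exact: dCx].
      rewrite dotpDl -[LHS]addr0; congr (_ + _).
      elim/big_rec: _ => [|k y _ IH]; first by rewrite /dotp mul0mx mxE.
      by rewrite dotpDl dotpZl -rowG -det_stack_last det_stack_last_row mulr0 add0r.
    rewrite dotpE mulr_sumr; apply: eq_bigr => j _.
    by rewrite !mxE partial_F_lam// mulrCA mulrC mulrA.
  have : expands xe (fun x => \sum_j (nu x * cof x j) * dF j x)
      (\sum_j (nu xe * cof xe j) *: row j A).
    apply: expands_sum => j.
    apply: (@expandsM _ _ xe (fun x => nu x * cof x j)); last exact: dF_expands.
    apply: (@locally_lipschitzM _ _ xe nu).
      exact (smooth_locally_lipschitz openO snu Oxe).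
    apply: locally_lipschitzM; first exact: locally_lipschitz_cst.
    apply: locally_lipschitz_det => k l; under eq_fun do rewrite 2!mxE.
    by apply: stack_locally_lipschitz => // i; exact: locally_lipschitz_cst.
  move=> h e /h[r r0 H1].
  have /near_ballP[r2 r20 H2] := near_open openO Oxe.
  exists (Num.min r r2); first by rewrite lt_min r0.
  by move=> y; rewrite lt_min => /andP[y1 y2]; rewrite E ?H1//; exact: H2.
move=> z; rewrite det_stack_last [in RHS]dotpE mulr_sumr.
elim/big_ind2 : _ => [|x1 x2 y1 y2 <- <-|j _].
- by rewrite /dotp mul0mx mxE.
- by rewrite dotpDl.
- have zA := mulmx_sym_coord z j hess_F_lam_sym.
  rewrite dotpZl zA [(\row_ _ _) _ _]mxE /cof; ring.
Qed.

End system.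

(** * Lyapunov and Chetaev criteria *)

Lemma expands_all {R : realType} n p (F : 'I_p -> 'rV[R]_n -> R) (g : 'I_p -> 'rV[R]_n) x
    (e : R) : (forall i, expands x (F i) (g i)) -> 0 < e ->
  exists2 r : R, 0 < r & forall y, `|y - x| < r -> forall i,
    `|F i y - dotp (g i) (y - x)| <= e * `|y - x|.
Proof.
move=> HF e0; have /choice[r hr] : forall i, exists r : R, 0 < r /\
    forall y, `|y - x| < r -> `|F i y - dotp (g i) (y - x)| <= e * `|y - x|.
  by move=> i; have [r r0 H] := HF i e e0; exists r.
exists (\big[Num.min/1]_i r i).
  by apply/bigmin_gtP; split => // i _; case: (hr i).
move=> y /bigmin_gtP[_ yr] i; have [_] := hr i; apply; exact: yr.
Qed.

Lemma conserved_along {R : realType} n (O : set 'rV[R]_n) (X : 'rV[R]_n -> 'rV[R]_n)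
    (f : 'rV[R]_n -> R) (g : R -> 'rV[R]_n) (t : R) :
  (forall x, O x -> differentiable f x) -> (forall x, dotp (grad f x) (X x) = 0) ->
  0 <= t -> (forall s : R, 0 <= s <= t -> O (g s) /\ is_derive s 1 g (X (g s))) ->
  f (g t) = f (g 0).
Proof.
move=> df fX t0 hg.
have dfg (s : R) : 0 <= s <= t -> is_derive s 1 (f \o g) 0.
  move=> /hg[Og dg]; rewrite -(fX (g s)); apply: is_derive_comp_grad => //.
  exact: df.
have [c _] := MVT_segment t0 (fun s sh => dfg s (subset_itv_oo_cc sh))
  (is_derive_within_continuous dfg).
by rewrite mul0r => /eqP; rewrite subr_eq0 => /eqP.
Qed.

(** Subtracting s^2 q / 2 from F along the segment cancels the leading part, so a single mean value
    theorem expresses the remainder by the first-order errors of the partial derivatives. *)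
Lemma second_order_expansion {R : realType} n (F : 'rV[R]_n -> R) xe (A : 'M[R]_n) (e : R) :
  (\forall x \near xe, differentiable F x) ->
  (forall i, expands xe (partial i F) (row i A)) -> A^T = A -> 0 < e ->
  exists2 r : R, 0 < r & forall x, `|x - xe| < r ->
    `|F x - F xe - dotp ((x - xe) *m A) (x - xe) / 2| <= e * `|x - xe| ^+ 2.
Proof.
move=> /near_ballP[r1 r10 dF] hF AT e0.
(* The [n] coordinate errors are summed; [n.+1] keeps the divisor positive when [n] is 0. *)
have e1 : 0 < e / n.+1%:R by rewrite divr_gt0.
have [r2 r20 H2] := expands_all hF e1.
exists (Num.min r1 r2); first by rewrite lt_min r10.
move=> x; rewrite lt_min => /andP[x1 x2]; set xi := x - xe; set q := dotp _ xi.
have near (s : R) : 0 <= s <= 1 -> `|xe + s *: xi - xe| <= s * `|xi| /\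
    `|xe + s *: xi - xe| <= `|xi|.
  move=> /andP[s0 s1]; rewrite addrC addKr normrZ (ger0_norm s0); split => //.
  by rewrite ler_piMl.
pose phi (s : R) := F (xe + s *: xi) - s * (s * (q / 2)).
have dphi (s : R) : 0 <= s <= 1 ->
    is_derive s 1 phi (dotp (grad F (xe + s *: xi)) xi - s * q).
  move=> s01; have h1 : is_derive s 1 (fun s => F (xe + s *: xi)) (dotp (grad F (xe + s *: xi)) xi).
    by apply: is_derive_line; apply: dF; rewrite (le_lt_trans (near s s01).2).
  have h2 : is_derive s 1 (fun s : R => s * (s * (q / 2))) (s * q).
    by apply: is_derive_eq; rewrite /GRing.scale/=; field.
  exact: is_deriveB.
have [c] := MVT_segment ler01 (fun s sh => dphi s (subset_itv_oo_cc sh))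
  (is_derive_within_continuous dphi).
rewrite in_itv/= => c01; rewrite /phi scale1r scale0r addr0 !mul1r !mul0r !subr0 mulr1.
rewrite (addrC xe) subrK addrAC => ->.
have -> : c * q = \sum_i dotp (row i A) (c *: xi) * xi 0 i.
  rewrite /q dotpE mulr_sumr; apply: eq_bigr => i _.
  by rewrite dotpZr (mulmx_sym_coord _ _ AT) mulrA.
rewrite dotpE -sumrB (le_trans (ler_norm_sum _ _ _))//.
apply: (@le_trans _ _ (\sum_(i < n) (e / n.+1%:R * `|xi| ^+ 2))).
  apply: ler_sum => i _; rewrite -mulrBl normrM expr2 mulrA.
  apply: ler_pM => //; last exact: ler_coord_norm.
  have [n1 n2] := near c c01.
  have := H2 (xe + c *: xi) (le_lt_trans n2 x2) i.
  rewrite {2}(addrC xe) addrK [grad _ _ _ _]mxE => /le_trans; apply.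
  by rewrite ler_pM2l.
rewrite sumr_const card_ord -[leLHS]mulr_natr mulrAC ler_wpM2r ?sqr_ge0//.
by rewrite -mulrA ler_piMr ?(ltW e0)// mulrC ler_pdivrMr// mul1r ler_nat.
Qed.

(** On the sphere of radius [rho] the conserved [V] is at least c rho^2, while it starts below that
    value, so the sphere is never reached. *)
Lemma lyapunov_criterion {R : realType} m (O : set 'rV[R]_m.+2)
    (X : 'rV[R]_m.+2 -> 'rV[R]_m.+2) (xe : 'rV[R]_m.+2) (V : 'rV[R]_m.+2 -> R) (c : R) :
  open O -> O xe ->
  (exists r K : R, [/\ 0 < r, 0 <= K &
    forall y z, `|y - xe| < r -> `|z - xe| < r -> `|X y - X z| <= K * `|y - z|]) ->
  {for xe, continuous V} -> V xe = 0 -> 0 < c ->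
  (exists2 r : R, 0 < r & forall x, `|x - xe| < r -> c * `|x - xe| ^+ 2 <= V x) ->
  (forall (g : R -> 'rV[R]_m.+2) (t : R), 0 <= t ->
    (forall s : R, 0 <= s <= t -> O (g s) /\ is_derive s 1 g (X (g s))) ->
    V (g t) = V (g 0)) ->
  lyapunov_stable O X xe.
Proof.
move=> openO Oxe [rX [K [rX0 K0 lipX]]] cV Vxe c0 [rV rV0 lowV] consV eps eps0.
have /near_ballP[rO rO0 subO] := near_open openO Oxe.
pose r0 := Num.min rO (Num.min rX rV).
have r00 : 0 < r0 by rewrite !lt_min rO0 rX0.
have m0 : 0 < Num.min eps r0 by rewrite lt_min eps0.
pose rho := Num.min eps r0 / 2; have rho0 : 0 < rho by rewrite divr_gt0.
have : rho < Num.min eps r0 by rewrite /rho; lra.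
rewrite !lt_min => /and4P[rhoe rhoO rhoX rhoV].
have crho : 0 < c * rho ^+ 2 by rewrite mulr_gt0// exprn_gt0.
have [d1 d10 hd1] := continuous_ball cV crho.
exists (Num.min d1 rho); first by rewrite lt_min d10.
move=> x0 Ox0; rewrite lt_min => /andP[x0d x0r].
have Vx0 : V x0 < c * rho ^+ 2.
  have := hd1 _ x0d; rewrite Vxe sub0r normrN; exact: le_lt_trans (ler_norm _).
(* The equation is required only while [g] stays in the ball, so that the argument covers both
   genuine orbits and orbits of the truncated field; conservation is used up to the first exit
   time. *)
have trap (g : R -> 'rV[R]_m.+2) (t : R) : 0 <= t -> g 0 = x0 ->
    (forall s : R, 0 <= s <= t -> {for s, continuous g}) ->
    (forall s : R, 0 <= s <= t -> `|g s - xe| <= rho -> is_derive s 1 g (X (g s))) ->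
    `|g t - xe| < rho.
  move=> t0 g0 cg dg; rewrite ltNge; apply/negP => gt.
  have ch (s : R) : 0 <= s <= t -> {for s, continuous (fun s => `|g s - xe|)}.
    move=> st; apply: (@continuous_comp _ _ _ (fun s => g s - xe) (fun y => `|y|)).
      by apply: continuousB; [exact: cg|exact: cst_continuous].
    exact: norm_continuous.
  have h0 : `|g 0 - xe| < rho by rewrite g0.
  have [s [/andP[s0 st] hs below]] := first_exit t0 ch h0 gt.
  have : V (g s) = V (g 0).
    apply: consV => // s' /[dup] s's /below gs'; split.
      by apply: subO; rewrite (le_lt_trans gs').
    apply: dg => //; move: s's => /andP[-> s's]; exact: le_trans s's st.
  have := lowV (g s); rewrite hs g0 => /(_ rhoV); lra.
split; last first.
  move=> g a b a0 b0 g0 sol t /andP[t0 tb].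
  have sol' (s : R) : 0 <= s <= t -> is_derive s 1 g (X (g s)).
    by move=> /andP[s0 st]; apply: (sol s _).2; rewrite (lt_le_trans a0)// (le_lt_trans st).
  apply: lt_trans rhoe; apply: trap => // s st; last by move=> _; exact: sol'.
  exact: is_derive_continuous (sol' s st).
pose Y x := X (clamp xe rho x).
have rho0' := ltW rho0.
have lipY x y : `|Y x - Y y| <= (K + 1) * `|x - y|.
  have cl z := le_lt_trans (clamp_ball xe rho0' z) rhoX.
  rewrite (le_trans (lipX _ _ (cl x) (cl y)))// ler_pM ?lerDl//.
  exact: clamp_lipschitz.
have bY x : `|Y x| <= `|X xe| + K * rho.
  rewrite -[Y x](subrK (X xe)) (le_trans (ler_normD _ _))// addrC lerD2l.
  have xx : `|xe - xe| < rX by rewrite subrr normr0.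
  have := lipX _ _ (le_lt_trans (clamp_ball xe rho0' x) rhoX) xx.
  by move=> /le_trans; apply; rewrite ler_wpM2l// clamp_ball.
have K1 : 0 < K + 1 by rewrite ltr_wpDl.
have [g [a [a0 g0 dg]]] := @global_solution _ _ Y _ _ x0 K1 lipY bY.
have dg' (s : R) : a < s -> `|g s - xe| <= rho -> is_derive s 1 g (X (g s)).
  by move=> sa gs; have := dg s sa; rewrite /Y clamp_id.
have cg (s : R) : a < s -> {for s, continuous g}.
  by move=> sa; exact: is_derive_continuous (dg s sa).
have fwd (t : R) : 0 <= t -> `|g t - xe| < rho.
  move=> t0; apply: trap => // s /andP[s0 _]; first by apply: cg; exact: lt_le_trans s0.
  by apply: dg'; exact: lt_le_trans s0.
have cn : {for 0, continuous (fun s => `|g s - xe|)}.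
  apply: (@continuous_comp _ _ _ (fun s => g s - xe) (fun y => `|y|)).
    by apply: continuousB; [exact: cg|exact: cst_continuous].
  exact: norm_continuous.
(* A solution must also exist for some negative times; by continuity the orbit is still in the ball
   shortly before time 0, where the truncated field agrees with [X]. *)
have gap : 0 < rho - `|g 0 - xe| by rewrite subr_gt0 fwd.
have [d d0 hd] := continuous_ball cn gap.
have bwd (s : R) : - d < s -> `|g s - xe| < rho.
  move=> ds; have [s0|s0] := leP 0 s; first exact: fwd.
  have := hd s; rewrite subr0 ltr0_norm// => /(_ _).
  rewrite distrC => H; have {}H := le_lt_trans (ler_norm _) (H _).
  by have := H ltac:(lra); lra.
exists g, (Num.max a (- d)); split => //; first by rewrite gt_max a0 oppr_lt0.
move=> b b0 t /andP[]; rewrite gt_max => /andP[ta td] _.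
have gt := bwd t td; split; first by apply: subO; exact: lt_trans gt _.
by apply: dg' => //; exact: ltW.
Qed.

Lemma locally_lipschitz_continuous {R : realType} n (f : 'rV[R]_n -> R) x :
  locally_lipschitz x f -> {for x, continuous f}.
Proof.
move=> [r [K [r0 K0 H]]]; apply: ball_continuous => e e0.
have K1 : 0 < K + 1 by rewrite ltr_wpDl.
exists (Num.min r (e / (K + 1))); first by rewrite lt_min r0 divr_gt0.
move=> y; rewrite lt_min => /andP[y1 y2].
have xx : `|x - x| < r by rewrite subrr normr0.
rewrite (le_lt_trans (H _ _ xx y1))//.
apply: (@le_lt_trans _ _ ((K + 1) * `|y - x|)).
  by rewrite distrC ler_wpM2r// lerDl.
by rewrite -ltr_pdivlMl// mulrC.
Qed.

(** * Energy-Casimir and Chetaev estimates in a conjugate frame *)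

Section normal_form.
Context {R : realType} {m : nat}.
Notation V := 'rV[R]_m.+2.
Variables (G : 'M[R]_(m, m.+2)) (A : 'M[R]_m.+2) (u v xe : V) (d : 'I_m -> V -> R).
Hypotheses (AT : A^T = A) (uG : u *m G^T = 0) (vG : v *m G^T = 0)
  (uv : dotp (u *m A) v = 0)
  (span : forall x : V, x *m G^T = 0 -> exists s t, x = s *: u + t *: v)
  (dG : forall k, expands xe (d k) (row k G)).
Let alpha := dotp (u *m A) u.
Let beta := dotp (v *m A) v.
Let S x := \sum_(k < m) d k x ^+ 2.

(** The [d k] agree to first order with the coordinates of [(x - xe) *m G^T], and each is at most
    the root of [S]. Thus [S] controls the displacement transverse to ker G, up to a small part of
    the full distance. *)
Lemma casimir_norm (e : R) : 0 < e -> exists2 r : R, 0 < r & forall x, `|x - xe| < r ->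
  `|(x - xe) *m G^T| <= Num.sqrt (S x) + e * `|x - xe|.
Proof.
move=> e0; have [r r0 H] := expands_all dG e0; exists r => // x xr.
apply: ler_row_norm => [|k].
  by rewrite addr_ge0 ?sqrtr_ge0// mulr_ge0// ltW.
have -> : ((x - xe) *m G^T) 0 k = dotp (row k G) (x - xe).
  by rewrite dotpC dotpE mxE; apply: eq_bigr => j _; rewrite !mxE.
have := H x xr k; set p := dotp _ _ => h.
have dk : `|d k x| <= Num.sqrt (S x).
  rewrite -sqrtr_sqr ler_wsqrtr// /S (bigD1 k)//= lerDl sumr_ge0// => j _.
  exact: sqr_ge0.
rewrite -[p](subrK (d k x)) (le_trans (ler_normD _ _))// addrC lerD//.
by rewrite distrC.
Qed.

Lemma energy_casimir_lower_bound (F : V -> R) :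
  (forall e : R, 0 < e -> exists2 r : R, 0 < r & forall x, `|x - xe| < r ->
    `|F x - F xe - dotp ((x - xe) *m A) (x - xe) / 2| <= e * `|x - xe| ^+ 2) ->
  0 < alpha * beta ->
  exists s k c r : R, [/\ 0 < c, 0 < r & forall x, `|x - xe| < r ->
    c * `|x - xe| ^+ 2 <= s * (F x - F xe) + k * S x].
Proof.
move=> hF ab.
have al0 : alpha != 0 by apply: contraTneq ab => ->; rewrite mul0r ltxx.
have be0 : beta != 0 by apply: contraTneq ab => ->; rewrite mulr0 ltxx.
have [s [s1 sa sb]] : exists s : R, [/\ `|s| = 1, 0 < s / alpha & 0 < s / beta].
  have [a0|a0] := ltP 0 alpha.
    exists 1; rewrite normr1 !divr_gt0//.
    by move: ab; rewrite pmulr_rgt0.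
  have {}a0 : alpha < 0 by rewrite lt_neqAle al0.
  exists (-1); rewrite normrN1 !mulN1r !oppr_gt0 !invr_lt0; split => //.
  by move: ab; rewrite nmulr_rgt0.
have [K2 K20 hK2] := frame_bound AT uv al0 be0 span.
have [K K0 hK] := frame_quadratic AT uG vG uv al0 be0 span.
(* Half of [k * Q ^+ 2], with [Q] the norm of [(x - xe) *m G^T], cancels the defect K Q^2 / 2 of the
   diagonalized form and leaves Q^2 / 2 for positivity. *)
pose k := K + 1.
pose mu := Num.min (s / alpha) (Num.min (s / beta) 1).
have mu0 : 0 < mu by rewrite !lt_min sa sb ltr01.
have [mua mub mu1] : [/\ mu <= s / alpha, mu <= s / beta & mu <= 1].
  by rewrite /mu !ge_min !lexx !orbT.
(* The factor 3 comes from (a + b + Q)^2 <= 3 (a^2 + b^2 + Q^2). The factor 4 gives 4 c N^2, halved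
   to 2 c N^2 by the 1/2 in the Taylor formula; one c N^2 is then spent on the errors, which the
   choice of [e] below bounds. *)
pose c := mu / (12 * K2 ^+ 2).
have c0 : 0 < c by rewrite divr_gt0// mulr_gt0// exprn_gt0.
have k0 : 0 < 1 + k by rewrite /k; lra.
pose e := Num.min 1 (c / (1 + k)).
have e0 : 0 < e by rewrite lt_min ltr01 divr_gt0.
have e1 : e <= 1 by rewrite ge_min lexx.
have ek : e * (1 + k) <= c by rewrite -ler_pdivlMr// ge_min lexx orbT.
have [r1 r10 H1] := hF e e0; have [r2 r20 H2] := casimir_norm e0.
exists s, k, c, (Num.min r1 r2); split; rewrite ?lt_min ?r10//.
move=> x; rewrite lt_min => /andP[/H1 h1 /H2 h2].
have h3 := hK2 (x - xe); have h4 := hK (x - xe).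
have S0 : 0 <= S x by apply: sumr_ge0 => j _; exact: sqr_ge0.
have qS := sqr_sqrtr S0; have sS := sqrtr_ge0 (S x).
have N0 := normr_ge0 (x - xe); have Q0 := normr_ge0 ((x - xe) *m G^T).
move: h1 h2 h3 h4 qS sS N0 Q0.
set N := `|x - xe|; set Q := `|_ *m _|; set a := dotp (u *m A) _.
set b := dotp (v *m A) _; set q := dotp _ (x - xe); set f := F x - F xe.
set w := Num.sqrt _ => h1 h2 h3 h4 qS sS N0 Q0.
have {}h1 : s * (q / 2) - e * N ^+ 2 <= s * f.
  have : `|s * (f - q / 2)| <= e * N ^+ 2 by rewrite normrM s1 mul1r.
  by rewrite ler_norml => /andP[+ _]; lra.
have {}h4 : a ^+ 2 * (s / alpha) + b ^+ 2 * (s / beta) - K * Q ^+ 2 <= s * q.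
  have : `|s * (q - a ^+ 2 / alpha - b ^+ 2 / beta)| <= K * Q ^+ 2 by rewrite normrM s1 mul1r.
  rewrite ler_norml => /andP[+ _].
  have -> : s * (q - a ^+ 2 / alpha - b ^+ 2 / beta) =
    s * q - (a ^+ 2 * (s / alpha) + b ^+ 2 * (s / beta)) by field; rewrite al0 be0.
  lra.
have h5 : Q ^+ 2 <= 2 * S x + 2 * (e ^+ 2 * N ^+ 2).
  have : Q ^+ 2 <= (w + e * N) ^+ 2 by rewrite lerXn2r// nnegrE addr_ge0// mulr_ge0// ltW.
  have := sqr_ge0 (w - e * N); rewrite -qS; lra.
have h6 : N ^+ 2 <= 3 * K2 ^+ 2 * (a ^+ 2 + b ^+ 2 + Q ^+ 2).
  have : N ^+ 2 <= (K2 * (`|a| + `|b| + Q)) ^+ 2.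
    by rewrite lerXn2r// nnegrE// mulr_ge0// ?addr_ge0// ltW.
  rewrite exprMn -(real_normK (num_real a)) -(real_normK (num_real b)).
  move: `|a| `|b| => a' b' /le_trans; apply.
  rewrite (mulrC 3) -(mulrA (K2 ^+ 2)) ler_pM2l ?exprn_gt0//.
  have := sqr_ge0 (a' - b'); have := sqr_ge0 (a' - Q); have := sqr_ge0 (b' - Q); lra.
have h7 : 4 * c * N ^+ 2 <= mu * (a ^+ 2 + b ^+ 2 + Q ^+ 2).
  have -> : mu = 4 * c * (3 * K2 ^+ 2) by rewrite /c; field; rewrite gt_eqF.
  by rewrite -[leRHS]mulrA ler_pM2l// mulr_gt0.
have h8 : mu * (a ^+ 2 + b ^+ 2 + Q ^+ 2) <=
    a ^+ 2 * (s / alpha) + b ^+ 2 * (s / beta) + Q ^+ 2.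
  rewrite mulrDr mulrDr !lerD//.
  - by rewrite mulrC ler_wpM2l// sqr_ge0.
  - by rewrite mulrC ler_wpM2l// sqr_ge0.
  - by rewrite ler_piMl// sqr_ge0.
have h9 : (e + k * e ^+ 2) * N ^+ 2 <= c * N ^+ 2.
  rewrite ler_wpM2r ?sqr_ge0// (le_trans _ ek)// mulrDr mulr1 lerD2l mulrC.
  have k0' : 0 <= k by rewrite /k addr_ge0.
  by rewrite ler_wpM2r// expr2 ler_piMr// ltW.
have h10 : k * Q ^+ 2 <= k * (2 * S x + 2 * (e ^+ 2 * N ^+ 2)).
  by rewrite ler_wpM2l// /k addr_ge0.
move: h9 h10; rewrite /k; move: (S x) (N ^+ 2) (Q ^+ 2) (a ^+ 2) (b ^+ 2) (e ^+ 2) h1 h4 h7 h8.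
move=> {h2 h3 h5 h6}.
move: (s / alpha) (s / beta) => ia ib SS NN QQ aa bb ee h1 h4 h7 h8 h9 h10.
lra.
Qed.

(* The linear parts [g1], [g2] say that [a' = om / beta * b] and [b' = - om / alpha * a] to
   first order, so [(a * b)'] is definite when [alpha * beta < 0]; the Casimirs only
   contribute through [S], which the hypothesis [S x <= s * (a * b)] dominates. *)
Lemma chetaev_estimate (X : V -> V) (om s : R) (g1 g2 : V) :
  expands xe (fun x => dotp (u *m A) (X x)) g1 ->
  (forall z, dotp g1 z = om / beta * dotp (v *m A) z) ->
  expands xe (fun x => dotp (v *m A) (X x)) g2 ->
  (forall z, dotp g2 z = - (om / alpha * dotp (u *m A) z)) ->
  alpha != 0 -> beta != 0 -> `|s| = 1 -> 0 < s * om / beta -> 0 < - (s * om / alpha) ->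
  exists c r : R, [/\ 0 < c, 0 < r & forall x, `|x - xe| < r ->
    let a := dotp (u *m A) (x - xe) in let b := dotp (v *m A) (x - xe) in
    S x <= s * (a * b) ->
    c * (s * (a * b)) <= s * (dotp (u *m A) (X x) * b + a * dotp (v *m A) (X x))].
Proof.
move=> ex1 g1E ex2 g2E al0 be0 s1 p0 q0.
have [K K0 hK] := frame_bound AT uv al0 be0 span.
pose mu := Num.min (s * om / beta) (- (s * om / alpha)).
have mu0 : 0 < mu by rewrite lt_min p0.
have [mup muq] : mu <= s * om / beta /\ mu <= - (s * om / alpha).
  by rewrite /mu !ge_min !lexx orbT.
(* When [S] is at most s a b, its root is at most T = |a| + |b|; with the tolerance 1 / (2 K) below,
   half of the distance is absorbed and it is at most 4 K T. This [e] then makes each linearization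
   error at most mu T / 4. *)
pose e := mu / (16 * K); have e0 : 0 < e by rewrite divr_gt0// mulr_gt0.
have e20 : 0 < (2 * K)^-1 by rewrite invr_gt0 mulr_gt0.
have [r1 r10 H1] := ex1 e e0; have [r2 r20 H2] := ex2 e e0.
have [r3 r30 H3] := casimir_norm e20.
exists (mu / 4), (Num.min r1 (Num.min r2 r3)); split; rewrite ?lt_min ?r10 ?r20//.
  by rewrite divr_gt0.
move=> x; rewrite !lt_min => /and3P[/H1 h1 /H2 h2 /H3 h3] /=.
have S0 : 0 <= S x by apply: sumr_ge0 => j _; exact: sqr_ge0.
have := hK (x - xe); move: h1 h2 h3; rewrite g1E g2E.
set a := dotp (u *m A) (x - xe); set b := dotp (v *m A) (x - xe).
set N := `|x - xe|; set Q := `|_ *m _|; set a' := dotp _ (X x); set b' := dotp _ (X x).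
move=> h1 h2 h3 h4 hS.
pose T := `|a| + `|b|.
have T0 : 0 <= T by rewrite addr_ge0.
have sab : s * (a * b) <= `|a| * `|b|.
  by rewrite (le_trans (ler_norm _))// !normrM s1 mul1r.
have TT : `|a| * `|b| <= T ^+ 2.
  rewrite /T sqrrD; have := normr_ge0 a; have := normr_ge0 b; move: `|a| `|b| => a1 b1; nra.
have sqS : Num.sqrt (S x) <= T.
  rewrite -[T]ger0_norm// -sqrtr_sqr ler_wsqrtr//.
  by rewrite (le_trans hS)// (le_trans sab).
have N0 : 0 <= N by exact: normr_ge0.
have NT : N <= 4 * K * T.
  have : K * Q <= K * (T + (2 * K)^-1 * N).
    by rewrite ler_pM2l// (le_trans h3)// lerD2r.
  have -> : K * (T + (2 * K)^-1 * N) = K * T + N / 2 by field; rewrite gt_eqF.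
  move: h4; rewrite -/T mulrDr; lra.
have eNT : e * N <= mu / 4 * T.
  apply: le_trans (ler_wpM2l (ltW e0) NT) _.
  by rewrite le_eqVlt; apply/orP; left; apply/eqP; rewrite /e; field; rewrite gt_eqF.
pose d1 := a' - om / beta * b; pose d2 := b' - - (om / alpha * a).
have E : s * (a' * b + a * b') =
    s * om / beta * b ^+ 2 + - (s * om / alpha) * a ^+ 2 + s * (d1 * b + a * d2).
  by rewrite /d1 /d2; ring.
have err : - (mu / 4 * T ^+ 2) <= s * (d1 * b + a * d2).
  have : `|s * (d1 * b + a * d2)| <= mu / 4 * T ^+ 2.
    rewrite normrM s1 mul1r (le_trans (ler_normD _ _))// !normrM.
    have -> : mu / 4 * T ^+ 2 = mu / 4 * T * `|b| + `|a| * (mu / 4 * T) by rewrite /T; ring.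
    rewrite lerD//.
      by rewrite ler_wpM2r// (le_trans h1).
    by rewrite ler_wpM2l// (le_trans h2).
  by rewrite ler_norml => /andP[].
have main : mu / 2 * T ^+ 2 <= s * om / beta * b ^+ 2 + - (s * om / alpha) * a ^+ 2.
  apply: (@le_trans _ _ (mu * (b ^+ 2 + a ^+ 2))).
    rewrite -mulrA ler_pM2l// -(real_normK (num_real a)) -(real_normK (num_real b)) /T.
    have := sqr_ge0 (`|a| - `|b|); lra.
  by rewrite mulrDr lerD// ler_wpM2r// sqr_ge0.
have : mu / 4 * (s * (a * b)) <= mu / 4 * T ^+ 2.
  by rewrite ler_pM2l ?divr_gt0// (le_trans sab).
rewrite E; move: (T ^+ 2) err main => TT'.
move: (s * (a * b)) (s * (d1 * b + a * d2)) (_ + _) => *; lra.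
Qed.

End normal_form.

Lemma is_derive_dotp {R : realType} n (g : R -> 'rV[R]_n) (t : R) (w x0 z : 'rV[R]_n) :
  is_derive t 1 g z -> is_derive t 1 (fun s => dotp w (g s - x0)) (dotp w z).
Proof.
move=> dg; have -> : (fun s => dotp w (g s - x0)) =
    \sum_i w 0 i *: (fun s => g s 0 i - x0 0 i).
  apply/funext => s; rewrite fct_sumE dotpE; apply: eq_bigr => i _.
  by rewrite !mxE.
rewrite dotpE; apply: is_derive_sum => i; apply: is_deriveZ.
rewrite -[z 0 i]subr0; apply: is_deriveB.
exact: is_derive_coord.
Qed.

(* [P - S] is bounded near [xe], while [S] is constant along orbits and [P] grows at
   least linearly along an orbit as long as [P - S] stays positive. *)
Lemma chetaev_criterion {R : realType} m (O : set 'rV[R]_m.+2)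
    (X : 'rV[R]_m.+2 -> 'rV[R]_m.+2) (xe : 'rV[R]_m.+2)
    (P dP S : 'rV[R]_m.+2 -> R) (c r B : R) :
  0 < c -> 0 < r -> (forall x, 0 <= S x) ->
  (forall x, `|x - xe| < r -> P x <= B) ->
  (forall (g : R -> 'rV[R]_m.+2) (t : R), is_derive t 1 g (X (g t)) ->
    is_derive t 1 (P \o g) (dP (g t))) ->
  (forall (g : R -> 'rV[R]_m.+2) (t : R), 0 <= t ->
    (forall s : R, 0 <= s <= t -> O (g s) /\ is_derive s 1 g (X (g s))) ->
    S (g t) = S (g 0)) ->
  (forall x, `|x - xe| < r -> S x <= P x -> c * P x <= dP x) ->
  (forall e : R, 0 < e -> exists x, [/\ `|x - xe| < e, O x & S x < P x]) ->
  unstable O X xe.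
Proof.
move=> c0 r0 S0 PB dPg consS grow start stab.
have [de de0 Hstab] := stab r r0.
(* Assumed stability for the radius [r] provides an orbit from this point, defined for all positive
   times and confined to the ball where the growth estimate holds. *)
have [x0 [x0d Ox0 W0]] := start de de0.
have [[g [a [a0 g0 sol]]] stay] := Hstab x0 Ox0 x0d.
have sol' (t : R) : 0 <= t -> O (g t) /\ is_derive t 1 g (X (g t)).
  move=> t0; apply: (sol (t + 1)); first by rewrite ltr_wpDl.
  by rewrite (lt_le_trans a0)//= ltrDl.
have ball (t : R) : 0 <= t -> `|g t - xe| < r.
  move=> t0; have b0 : 0 < t + 1 by rewrite ltr_wpDl.
  by apply: (stay g a (t + 1) a0 b0 g0 (sol _ b0)); rewrite t0 ltrDl ltr01.
have Sg (t : R) : 0 <= t -> S (g t) = S x0.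
  by move=> t0; rewrite -g0; apply: consS => // s /andP[s0 _]; exact: sol'.
have dPt (t : R) : 0 <= t -> is_derive t 1 (P \o g) (dP (g t)).
  by move=> /sol'[_]; exact: dPg.
pose w := P x0 - S x0; have w0 : 0 < w by rewrite subr_gt0.
(* Until [P] first falls to this level it exceeds the constant [S], so it does not decrease and
   stays above its initial value S x0 + w; the level is never reached. *)
have low (t : R) : 0 <= t -> S x0 + w / 2 <= P (g t).
  move=> t0; rewrite leNgt; apply/negP => Pt.
  have ch (s : R) : 0 <= s <= t -> {for s, continuous (- (P \o g))}.
    by move=> /andP[s0 _]; apply: continuousN; exact: is_derive_continuous (dPt s s0).
  have h0 : (- (P \o g)) 0 < - (S x0 + w / 2).
    by rewrite -[(- _) 0]/(- P (g 0)) g0 ltrN2 /w; move: w0; rewrite /w; lra.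
  have h1 : - (S x0 + w / 2) <= (- (P \o g)) t.
    by rewrite -[(- _) t]/(- P (g t)) lerN2 ltW.
  have [s [/andP[s0 _] hs below]] := first_exit t0 ch h0 h1.
  have z0 (s' : R) : 0 <= s' <= s -> is_derive s' 1 (cst 0 : R -> R) 0.
    by move=> _; exact: is_derive_cst.
  have := @is_derive_le R (cst 0) (P \o g) (fun=> 0) (fun s => dP (g s)) 0 s s0 z0.
  rewrite /= subrr g0 => mono.
  have : 0 <= P (g s) - P x0.
    apply: mono => s' /[dup] ss /andP[s'0 _]; first exact: dPt.
    have := below s' ss; rewrite -[(- _) s']/(- P (g s')) lerN2 => Ps'.
    have SP : S (g s') <= P (g s') by rewrite Sg// (le_trans _ Ps')// lerDl divr_ge0// ltW.
    apply: le_trans (grow _ (ball s' s'0) SP).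
    by rewrite mulr_ge0 ?(ltW c0)// (le_trans (S0 (g s'))).
  move: hs; rewrite -[(- _) s]/(- P (g s)); move: w0; rewrite /w; lra.
pose k := c * (w / 2); have k0 : 0 < k by rewrite mulr_gt0// divr_gt0.
have lin (t : R) : 0 <= t -> k * t <= P (g t) - P x0.
  move=> t0; have dk (s : R) : 0 <= s <= t -> is_derive s 1 (fun s => k * s) k.
    by move=> _; apply: is_derive_eq; rewrite /GRing.scale/= mulr1.
  have := @is_derive_le R (fun s => k * s) (P \o g) (fun=> k) (fun s => dP (g s)) 0 t t0 dk.
  rewrite /= mulr0 subr0 g0; apply => s /andP[s0 _]; first exact: dPt.
  have SP : S (g s) <= P (g s) by rewrite Sg// (le_trans _ (low s s0))// lerDl divr_ge0// ltW.
  apply: le_trans (grow _ (ball s s0) SP); rewrite ler_pM2l//.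
  by rewrite (le_trans _ (low s s0))// lerDr.
have P0 : 0 < P x0 by rewrite (le_lt_trans (S0 x0)).
have B0 : 0 < B.
  by rewrite (lt_le_trans P0)// PB// -g0 ball.
(* At this time linear growth gives P >= P x0 + B, which exceeds the bound [B]. *)
have t0 : 0 <= B / k by rewrite divr_ge0// ltW.
have := lin _ t0; have := PB _ (ball _ t0).
rewrite (mulrC k) divfK ?gt_eqF//; lra.
Qed.

(** * The two criteria applied to the Hamiltonian field *)

Section system.
Context {R : realType} {m : nat}.
Notation V := 'rV[R]_m.+2.
Variables (O : set V) (nu : V -> R) (C : 'I_m -> V -> R) (H : V -> R)
  (xe : V) (lam : 'I_m -> R).
Hypotheses (openO : open O) (snu : smooth_on O nu)
  (sC : forall k, smooth_on O (C k)) (sH : smooth_on O H)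
  (Oxe : O xe) (nu0 : nu xe != 0) (crit : grad H xe + \sum_(k < m) lam k *: grad (C k) xe = 0).

Let X := vfield nu C H.
Let G : 'M[R]_(m, m.+2) := rows_mx (fun k => grad (C k) xe).
Let F := F_lam C H lam.
Let A := hess F xe.
Let d k x := C k x - C k xe.

Hypotheses (Gf : row_free G) (A0 : \det A != 0).

Let AT : A^T = A. Proof. exact (hess_F_lam_sym openO sC sH lam Oxe). Qed.

Lemma I_X_E : I_X nu C H lam xe =
  nu xe ^+ 2 * (\det A * \det (G *m invmx A *m G^T)).
Proof.
rewrite /I_X -/F -/A -mulrA; congr (_ * (_ * \det _)).
apply/matrixP => i j; rewrite mxE dotpE mxE; apply: eq_bigr => k _.
rewrite !mxE; congr (_ * _); apply: eq_bigr => l _; rewrite !mxE mulrC; congr (_ * _).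
by rewrite -[in LHS]AT -trmx_inv mxE.
Qed.

Let dG k : expands xe (d k) (row k G).
Proof.
have -> : row k G = grad (C k) xe by apply/rowP => j; rewrite !mxE.
exact (differentiable_expands (smooth_differentiable (sC k) Oxe)).
Qed.

Let dC_conserved k (g : R -> V) (t : R) : 0 <= t ->
  (forall s : R, 0 <= s <= t -> O (g s) /\ is_derive s 1 g (X (g s))) ->
  C k (g t) = C k (g 0).
Proof.
apply: conserved_along => [x|x]; first exact: smooth_differentiable.
exact: casimir_conserved.
Qed.

Let F_conserved (g : R -> V) (t : R) : 0 <= t ->
  (forall s : R, 0 <= s <= t -> O (g s) /\ is_derive s 1 g (X (g s))) ->
  F (g t) = F (g 0).
Proof.
move=> t0 sol; rewrite /F /F_lam; congr (_ + _).
  apply: (conserved_along _ _ t0 sol) => x; first exact: smooth_differentiable.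
  exact: hamiltonian_conserved.
by apply: eq_bigr => k _; rewrite (dC_conserved k t0 sol).
Qed.

Let S_conserved (g : R -> V) (t : R) : 0 <= t ->
  (forall s : R, 0 <= s <= t -> O (g s) /\ is_derive s 1 g (X (g s))) ->
  \sum_(k < m) d k (g t) ^+ 2 = \sum_(k < m) d k (g 0) ^+ 2.
Proof.
by move=> t0 sol; apply: eq_bigr => k _; rewrite /d (dC_conserved k t0 sol).
Qed.

Lemma definite_stable : 0 < I_X nu C H lam xe -> lyapunov_stable O X xe.
Proof.
rewrite I_X_E pmulr_rgt0 ?exprn_even_gt0// => D0.
have g0 : \det (G *m invmx A *m G^T) != 0.
  by apply: contraTneq D0 => ->; rewrite mulr0 ltxx.
have [u [v [uG vG uv]]] := conjugate_frame Gf AT A0 g0.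
rewrite pmulr_rgt0// => ab span.
have F2 (e : R) : 0 < e -> exists2 r : R, 0 < r & forall x, `|x - xe| < r ->
    `|F x - F xe - dotp ((x - xe) *m A) (x - xe) / 2| <= e * `|x - xe| ^+ 2.
  apply: second_order_expansion => //.
    apply: filterS (near_open openO Oxe) => x Ox.
    by apply: differentiable_F_lam => [|k]; [exact (smooth_differentiable sH Ox)|exact (smooth_differentiable (sC k) Ox)].
  move=> i e' e'0; have [r r0 hr] := dF_expands openO sC sH Oxe crit i e'0.
  have /near_ballP[r2 r20 hr2] := near_open openO Oxe.
  exists (Num.min r r2); first by rewrite lt_min r0.
  move=> y; rewrite lt_min => /andP[y1 y2].
  by rewrite (partial_F_lam sC sH lam i (hr2 y y2)); exact: hr.
have [s [k [c [r [c0 r0 low]]]]] := energy_casimir_lower_bound AT uG vG uv span dG F2 ab.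
apply: (@lyapunov_criterion _ _ _ _ _
  (fun x => s * (F x - F xe) + k * \sum_(j < m) d j x ^+ 2) c) => //.
- exact (vfield_locally_lipschitz openO snu sC sH Oxe).
- apply: locally_lipschitz_continuous.
  have lipC j : locally_lipschitz xe (C j) by exact (smooth_locally_lipschitz openO (sC j) Oxe).
  have lipH : locally_lipschitz xe H by exact (smooth_locally_lipschitz openO sH Oxe).
  apply: locally_lipschitzD; apply: locally_lipschitzM; try exact: locally_lipschitz_cst.
    apply: locally_lipschitzD; last exact: locally_lipschitz_cst.
    apply: locally_lipschitzD => //; apply: locally_lipschitz_sum => j _.
    by apply: locally_lipschitzM => //; exact: locally_lipschitz_cst.
  apply: locally_lipschitz_sum => j _; rewrite /d.
  have dj : locally_lipschitz xe (fun x => C j x - C j xe).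
    by apply: locally_lipschitzD => //; exact: locally_lipschitz_cst.
  exact: locally_lipschitzM.
- rewrite subrr mulr0 add0r big1 ?mulr0// => j _.
  by rewrite /d subrr expr0n.
- by exists r.
- by move=> g t t0 sol; rewrite (F_conserved t0 sol) (S_conserved t0 sol).
Qed.

Lemma indefinite_unstable : I_X nu C H lam xe < 0 -> unstable O X xe.
Proof.
rewrite I_X_E pmulr_rlt0 ?exprn_even_gt0// => D0.
have g0 : \det (G *m invmx A *m G^T) != 0.
  by apply: contraTneq D0 => ->; rewrite mulr0 ltxx.
have [u [v [uG vG uv]]] := conjugate_frame Gf AT A0 g0.
rewrite nmulr_rgt0// => ab span.
set alpha := dotp (u *m A) u in ab; set beta := dotp (v *m A) v in ab.
have al0 : alpha != 0 by apply: contraTneq ab => ->; rewrite mul0r ltxx.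
have be0 : beta != 0 by apply: contraTneq ab => ->; rewrite mulr0 ltxx.
(* Nonzero because no nonzero vector is orthogonal to all its rows, by [frame_inj]. *)
pose om0 := \det (stack G (u *m A) (v *m A)).
have om00 : om0 != 0.
  by apply: det_stack_neq0 => x; exact: (frame_inj AT uv al0 be0 span).
pose om := nu xe * om0; have omn0 : om != 0 by rewrite mulf_neq0.
have [g1 ex1 g1E] := vfield_expands openO snu sC sH Oxe crit (u *m A).
have [g2 ex2 g2E] := vfield_expands openO snu sC sH Oxe crit (v *m A).
have {}g1E z : dotp g1 z = om / beta * dotp (v *m A) z.
  by rewrite g1E (det_stack_frame z AT uG vG uv al0 be0) -/beta -/om0 /om; ring.
have {}g2E z : dotp g2 z = - (om / alpha * dotp (u *m A) z).
  have vu : dotp (v *m A) u = 0 by rewrite dotp_sym.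
  rewrite g2E (det_stack_frame z AT vG uG vu be0 al0) -/alpha det_stackC -/om0 /om.
  by ring.
(* As alpha beta < 0, the coefficients om / beta and - om / alpha have the same sign; [s] is that
   sign. *)
have [s [s1 p0 q0]] : exists s : R,
    [/\ `|s| = 1, 0 < s * om / beta & 0 < - (s * om / alpha)].
  have E : om / alpha = om / beta * (alpha * beta) / alpha ^+ 2.
    by field; rewrite al0 be0.
  have a2 : 0 < (alpha ^+ 2)^-1 by rewrite invr_gt0 exprn_even_gt0.
  have ob : om / beta != 0 by rewrite mulf_neq0// invr_eq0.
  have [p|p] := ltP 0 (om / beta).
    exists 1; rewrite normr1 !mul1r E oppr_gt0 pmulr_llt0// pmulr_rlt0//.
  have {}p : om / beta < 0 by rewrite lt_neqAle ob.
  exists (-1); rewrite normrN1 -!(mulrA (-1)) !mulN1r oppr_gt0 opprK E.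
  by rewrite pmulr_lgt0// nmulr_rgt0.
have [c [r [c0 r0 est]]] :=
  chetaev_estimate AT uv span dG ex1 g1E ex2 g2E al0 be0 s1 p0 q0.
pose a x := dotp (u *m A) (x - xe); pose b x := dotp (v *m A) (x - xe).
pose S x := \sum_(k < m) d k x ^+ 2.
pose ca := \sum_i `|(u *m A) 0 i|; pose cb := \sum_i `|(v *m A) 0 i|.
apply: (@chetaev_criterion _ _ _ _ _ (fun x => s * (a x * b x))
  (fun x => s * (dotp (u *m A) (X x) * b x + a x * dotp (v *m A) (X x))) S c r
  (ca * r * (cb * r))) => //.
- by move=> x; apply: sumr_ge0 => k _; exact: sqr_ge0.
- move=> x xr; rewrite (le_trans (ler_norm _))// !normrM s1 mul1r.
  apply: ler_pM => //.
    by rewrite (le_trans (ler_norm_dotp _ _))// ler_wpM2l ?sumr_ge0// ltW.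
  by rewrite (le_trans (ler_norm_dotp _ _))// ler_wpM2l ?sumr_ge0// ltW.
- move=> g t dg.
  have da := is_derive_dotp (u *m A) xe dg; have db := is_derive_dotp (v *m A) xe dg.
  have dab := is_deriveZ s (is_deriveM da db).
  apply: (is_derive_eq (f' := _) dab).
  by rewrite /GRing.scale/= /a /b; ring.
(* A direction in ker G on which s a b equals - alpha beta > 0. Along it the Casimirs have no
   first-order variation, so [S] is negligible against tau^2. *)
pose z := u - s *: v.
have s2 : s ^+ 2 = 1 by rewrite -(real_normK (num_real s)) s1 expr1n.
have az : dotp (u *m A) z = alpha.
  by rewrite /z -scaleN1r !dotpDr !dotpZr uv mulr0 mulr0 addr0.
have bz : dotp (v *m A) z = - (s * beta).
  by rewrite /z -scaleN1r dotpDr !dotpZr (dotp_sym AT) uv add0r mulN1r.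
have zG : z *m G^T = 0 by rewrite /z mulmxBl -scalemxAl uG vG scaler0 subr0.
have Gz k : dotp (row k G) z = 0.
  have /rowP/(_ k) := zG; rewrite [RHS]mxE => <-.
  by rewrite dotpC dotpE [RHS]mxE; apply: eq_bigr => j _; rewrite !mxE.
(* Each of the [m] squares is at most e tau^2 |z|^2, using e^2 <= e; the extra 1 makes the final
   inequality strict. *)
pose M := m%:R * `|z| ^+ 2 + 1.
have M0 : 0 < M by rewrite ltr_wpDl// mulr_ge0// sqr_ge0.
have ga : 0 < - (alpha * beta) by rewrite oppr_gt0.
pose e := Num.min 1 (- (alpha * beta) / M).
have e0 : 0 < e by rewrite lt_min ltr01 divr_gt0.
have e1 : e <= 1 by rewrite ge_min lexx.
have eM : e * M <= - (alpha * beta) by rewrite -ler_pdivlMr// ge_min lexx orbT.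
have [r1 r10 H1] := expands_all dG e0.
have /near_ballP[r2 r20 H2] := near_open openO Oxe.
move=> eps eps0.
pose rr := Num.min eps (Num.min r1 r2).
have rr0 : 0 < rr by rewrite !lt_min eps0 r10.
have z1 : 0 < `|z| + 1 by rewrite ltr_wpDl.
pose tau := rr / 2 / (`|z| + 1); have tau0 : 0 < tau by rewrite !divr_gt0.
have dx : xe + tau *: z - xe = tau *: z by rewrite addrC addKr.
have : `|xe + tau *: z - xe| < rr.
  rewrite dx normrZ gtr0_norm//.
  apply: (@le_lt_trans _ _ (tau * (`|z| + 1))); first by rewrite ler_pM2l// lerDl.
  by rewrite /tau divfK ?gt_eqF//; lra.
rewrite !lt_min => /and3P[n1 n2 n3].
exists (xe + tau *: z); split => //; first exact: H2.
have := H1 _ n2; rewrite dx => Hd.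
have dk k : d k (xe + tau *: z) ^+ 2 <= e * (tau ^+ 2 * `|z| ^+ 2).
  have := Hd k; rewrite dotpZr Gz mulr0 subr0 normrZ (gtr0_norm tau0) => h.
  rewrite -(real_normK (num_real _)); apply: (@le_trans _ _ ((e * (tau * `|z|)) ^+ 2)).
    by rewrite lerXn2r// nnegrE !mulr_ge0// ltW.
  rewrite 2!exprMn; apply: ler_wpM2r; first by apply: mulr_ge0; exact: sqr_ge0.
  by rewrite expr2 ler_piMr// ltW.
rewrite /S /a /b dx !dotpZr az bz.
apply: (@le_lt_trans _ _ (\sum_(k < m) e * (tau ^+ 2 * `|z| ^+ 2))).
  by apply: ler_sum => k _; exact: dk.
rewrite sumr_const card_ord -mulr_natr.
have -> : s * (tau * alpha * (tau * - (s * beta))) = s ^+ 2 * (tau ^+ 2 * - (alpha * beta)).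
  by ring.
rewrite s2 mul1r.
apply: (@lt_le_trans _ _ (tau ^+ 2 * (e * M))); last by rewrite ler_pM2l// exprn_gt0.
have -> : e * (tau ^+ 2 * `|z| ^+ 2) * m%:R = tau ^+ 2 * (e * (m%:R * `|z| ^+ 2)) by ring.
by rewrite ltr_pM2l ?exprn_gt0// ltr_pM2l// /M ltrDl.
Qed.

End system.

Unset Implicit Arguments.

Theorem theorem5p7 (R : realType) (m : nat) (O : set 'rV[R]_m.+2)
  (nu : 'rV[R]_m.+2 -> R) (C : 'I_m -> 'rV[R]_m.+2 -> R)
  (H : 'rV[R]_m.+2 -> R) (xe : 'rV[R]_m.+2) (lam : 'I_m -> R) :
  open O ->
  smooth_on O nu -> (forall i, smooth_on O (C i)) -> smooth_on O H ->
  regular_equilibrium O nu C H xe ->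
  grad H xe + \sum_(i < m) lam i *: grad (C i) xe = 0 ->
  \det (hess (F_lam C H lam) xe) != 0 ->
  (I_X nu C H lam xe < 0 -> unstable O (vfield nu C H) xe) /\
  (0 < I_X nu C H lam xe -> lyapunov_stable O (vfield nu C H) xe).
Proof.
move=> openO snu sC sH [Oxe nu0 Gf _] crit A0; split.
  exact (indefinite_unstable openO snu sC sH Oxe nu0 crit Gf A0).
exact (definite_stable openO snu sC sH Oxe nu0 crit Gf A0).
Qed.
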